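(* For a triangle-free graph $G$, we have $$H_2(G)\cong\frac{\ker\left(d_1\colon H_2^{[2]}(G)\to H_1^{[1]}(G)\right)}{\operatorname{Im}\left(d_1\colon H_3^{[3]}(G)\to H_2^{[2]}(G)\right)} = H_2^{inj}(G).$$ Furthermore, for a triangle-free graph $G$ of cubical dimension $2$, $H_n(G)\cong H_n^{[2]}(G)$ for all $n\ge 3$.
   Context: Graphs are simple and undirected (no loops, no multiple edges). A graph map $f\colon G\to G'$ is a map of vertex sets sending every edge to an edge or to a single vertex. $I^n$ denotes the discrete $n$-cube graph, with vertex set $\{0,1\}^n$, two vertices being adjacent iff they differ in exactly one coordinate ($I^0$ is a single vertex). A singular $n$-cube in $G$ is a graph map $\sigma\colon I^n\to G$; it is injective if it is injective on vertices. For $1\le i\le n$, $f_i^-\sigma$ and $f_i^+\sigma$ are the singular $(n-1)$-cubes obtained by fixing the $i$-th coordinate equal to $0$ and $1$ respectively. $\sigma$ is degenerate if $f_i^-\sigma=f_i^+\sigma$ for some $i$. Let $Q_n(G)$ be the free abelian group on singular $n$-cubes, with $\partial_n\sigma=\sum_{i=1}^n(-1)^i(f_i^-\sigma-f_i^+\sigma)$, let $D_*(G)\subseteq Q_*(G)$ be the subcomplex generated by degenerate cubes, $C_*(G)=Q_*(G)/D_*(G)$, and $H_n(G)=H_n(C_*(G))$ (discrete cubical homology). The degree of a singular $n$-cube $\sigma$ is the largest dimension $k$ of an injective face of $\sigma$ (faces of all dimensions $0\le k\le n$, including $\sigma$ itself, obtained by fixing $n-k$ of the coordinates). $C_n^k(G)\le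 C_n(G)$ is the subgroup generated by the nondegenerate singular $n$-cubes of degree at most $k$ (with $C_n^{-1}(G)=0$); for each $k$ this gives a subcomplex $C_*^k(G)$. Put $C_*^{[k]}(G)=C_*^k(G)/C_*^{k-1}(G)$ and $H_n^{[k]}(G)=H_n(C_*^{[k]}(G))$. The maps $d_1\colon H_n^{[n]}(G)\to H_{n-1}^{[n-1]}(G)$ are the first differentials of the spectral sequence $E^1_{p,q}=H^{[p]}_{p+q}(G)\Rightarrow H_{p+q}(G)$ of this filtration: the class of a chain $z\in C_n^n(G)=C_n(G)$ is sent to the class of $\partial z\in C_{n-1}(G)=C_{n-1}^{n-1}(G)$. They satisfy $d_1\circ d_1=0$, and the injective homology is $H_n^{inj}(G)=H_n(H_\bullet^{[\bullet]}(G),d_1)$, the homology at $H_n^{[n]}(G)$ of the complex $H_0^{[0]}(G)\leftarrow H_1^{[1]}(G)\leftarrow H_2^{[2]}(G)\leftarrow\cdots$. The cubical dimension of $G$ is the maximal dimension of an injective singular cube in $G$. A graph is triangle-free if it contains no 3-cycle as a subgraph. *)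

(* Defs.v *)
(* Classical logic (boolp) turns images and generated subgroups of arbitrary
   abelian groups into boolean predicates, so that the library's quotients
   apply to them. *)
From HB Require Import structures.
From mathcomp.multinomials Require Import freeg.
From mathcomp Require Import all_boot all_algebra.
From mathcomp Require Import zify boolp.

Set Implicit Arguments.
Unset Strict Implicit.
Unset Printing Implicit Defensive.

Import GRing.Theory.
Local Open Scope ring_scope.
Local Open Scope quotient_scope.

Definition zmod_iso (A B : zmodType) : Prop :=
  exists f : {additive A -> B}, bijective f.

Definition kerz (U V : zmodType) (f : {additive U -> V}) : {pred U} :=
  [pred x | f x == 0].

Definition imz (U V : zmodType) (f : {additive U -> V}) : {pred V} :=
  [pred y | `[< exists x, f x = y >]].

Definition preimz (U V : zmodType) (f : {additive U -> V}) (S : zmodClosed V) :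
  {pred U} := [pred x | f x \in S].

Definition genz (V : zmodType) (P : V -> Prop) : {pred V} :=
  [pred x | `[< forall S : zmodClosed V, (forall y, P y -> y \in S) -> x \in S >]].

Section SubgroupInstances.
Variables (U V : zmodType) (f : {additive U -> V}).

Fact kerz_closed : zmod_closed (kerz f).
Proof.
split=> [|x y]; rewrite !inE ?raddf0 // => /eqP fx /eqP fy.
by rewrite raddfB fx fy subrr.
Qed.
HB.instance Definition _ := GRing.isZmodClosed.Build U (kerz f) kerz_closed.

Fact imz_closed : zmod_closed (imz f).
Proof.
split=> [|x y]; rewrite !inE; first by apply/asboolP; exists 0; rewrite raddf0.
move=> /asboolP[a <-] /asboolP[b <-]; apply/asboolP.
by exists (a - b); rewrite raddfB.
Qed.
HB.instance Definition _ := GRing.isZmodClosed.Build V (imz f) imz_closed.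

Fact preimz_closed (S : zmodClosed V) : zmod_closed (preimz f S).
Proof.
split=> [|x y]; rewrite !inE ?raddf0 ?rpred0 // => fx fy.
by rewrite raddfB rpredB.
Qed.
HB.instance Definition _ (S : zmodClosed V) :=
  GRing.isZmodClosed.Build U (preimz f S) (preimz_closed S).

Fact genz_closed (P : V -> Prop) : zmod_closed (genz P).
Proof.
split=> [|x y]; rewrite !inE; first by apply/asboolP => S _; rewrite rpred0.
move=> /asboolP Px /asboolP Py; apply/asboolP => S PS.
by rewrite rpredB ?Px ?Py.
Qed.
HB.instance Definition _ (P : V -> Prop) :=
  GRing.isZmodClosed.Build V (genz P) (genz_closed P).

Lemma mem_genz (P : V -> Prop) x : P x -> x \in genz P.
Proof. by move=> Px; rewrite inE; apply/asboolP => S; apply. Qed.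

Lemma genz_sub (P : V -> Prop) (S : zmodClosed V) :
  (forall y, P y -> y \in S) -> {subset genz P <= S}.
Proof. by move=> PS x; rewrite inE => /asboolP; apply. Qed.

End SubgroupInstances.

Record subz (V : zmodType) (S : zmodClosed V) :=
  Subz { subz_val : V; subzP : subz_val \in S }.

HB.instance Definition _ (V : zmodType) (S : zmodClosed V) :=
  [isSub of subz S for @subz_val V S].
HB.instance Definition _ (V : zmodType) (S : zmodClosed V) :=
  [Choice of subz S by <:].
HB.instance Definition _ (V : zmodType) (S : zmodClosed V) :=
  [SubChoice_isSubZmodule of subz S by <:].

Notation quotz I := (Quotient.quot I).

Section InducedMaps.

Lemma pi_eq0 (V : zmodType) (I : zmodClosed V) (x : V) :
  (\pi_(quotz I) x == 0) = (x \in I).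
Proof.
have -> : 0 = \pi_(quotz I) 0 by rewrite raddf0.
by rewrite -Quotient.idealrBE subr0.
Qed.

Variables (U V : zmodType) (f : {additive U -> V}).

Section Restriction.
Variables (S : zmodClosed U) (T : zmodClosed V).
Hypothesis fST : forall x, x \in S -> f x \in T.

Definition restrz (x : subz S) : subz T := Subz (fST (subzP x)).

Fact restrz_additive : zmod_morphism restrz.
Proof. by move=> x y; apply: val_inj; rewrite /= raddfB. Qed.
HB.instance Definition _ :=
  GRing.isZmodMorphism.Build (subz S) (subz T) restrz restrz_additive.
End Restriction.

Section Quotient.
Variables (I : zmodClosed U) (J : zmodClosed V).
Hypothesis fIJ : forall x, x \in I -> f x \in J.

(* The hypothesis is an argument so that the morphism instance below applies. *)
Definition quotz_map of (forall x, x \in I -> f x \in J) :=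
  fun x : quotz I => \pi_(quotz J) (f (repr x)).

Lemma quotz_mapE x : quotz_map fIJ (\pi_(quotz I) x) = \pi_(quotz J) (f x).
Proof.
apply/eqP; rewrite /quotz_map -subr_eq0 -raddfB pi_eq0 -raddfB fIJ //.
by rewrite -pi_eq0 raddfB /= reprK subrr.
Qed.

Fact quotz_map_additive : zmod_morphism (quotz_map fIJ).
Proof.
move=> x y; rewrite -[x]reprK -[y]reprK -raddfB /= !quotz_mapE.
by rewrite -raddfB -raddfB.
Qed.
HB.instance Definition _ :=
  GRing.isZmodMorphism.Build (quotz I) (quotz J) (quotz_map fIJ)
    quotz_map_additive.
End Quotient.

End InducedMaps.

Record complex := Complex {
  chain :> nat -> zmodType;
  bd : forall n, {additive chain n.+1 -> chain n};
  bdK : forall n x, bd n (bd n.+1 x) = 0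
}.

Definition cycles (K : complex) (n : nat) : {pred K n} :=
  match n return {pred K n} with
  | 0 => predT
  | m.+1 => kerz (bd K m)
  end.
Arguments cycles : clear implicits.

Fact cycles_closed (K : complex) n : zmod_closed (cycles K n).
Proof. by case: n => [|n]; [split | exact: kerz_closed]. Qed.
HB.instance Definition _ (K : complex) n :=
  GRing.isZmodClosed.Build (K n) (cycles K n) (cycles_closed K n).

Definition boundaries (K : complex) n : {pred K n} := imz (bd K n).
Arguments boundaries : clear implicits.
HB.instance Definition _ (K : complex) n := GRing.ZmodClosed.on (boundaries K n).

Definition homology (K : complex) (n : nat) : zmodType :=
  quotz (preimz (\val : {additive subz (cycles K n) -> K n}) (boundaries K n)).

Definition homology_class (K : complex) n (x : subz (cycles K n)) :
  homology K n := \pi_(quotz _) x.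

Record subcomplex (K : complex) := SubComplex {
  sub_at :> forall n, zmodClosed (K n);
  sub_bd : forall n x, x \in sub_at n.+1 -> bd K n x \in sub_at n
}.

Section SubQuotientComplex.
Variables (K : complex) (S : subcomplex K).

Definition subcx_bd n : {additive subz (S n.+1) -> subz (S n)} :=
  restrz (@sub_bd K S n).

Fact subcx_bdK n x : subcx_bd n (subcx_bd n.+1 x) = 0.
Proof. by apply: val_inj; rewrite /= bdK. Qed.

Definition subcx : complex := Complex subcx_bdK.

Definition quotcx_bd n : {additive quotz (S n.+1) -> quotz (S n)} :=
  quotz_map (@sub_bd K S n).

Fact quotcx_bdK n x : quotcx_bd n (quotcx_bd n.+1 x) = 0.
Proof. by rewrite -[x]reprK /= !quotz_mapE bdK raddf0. Qed.

Definition quotcx : complex := Complex quotcx_bdK.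

End SubQuotientComplex.

Section Subquotient.
Variables (K : complex) (S T : subcomplex K).

Definition sub_in_at n : zmodClosed (subcx S n) :=
  preimz (\val : {additive subz (S n) -> K n}) (T n).

Fact sub_in_bd n x : x \in sub_in_at n.+1 -> bd (subcx S) n x \in sub_in_at n.
Proof. by rewrite !inE; apply: sub_bd. Qed.

(* S / (S meet T), i.e. S / T when T is contained in S. *)
Definition subquotcx : complex := quotcx (SubComplex sub_in_bd).

End Subquotient.

Section ZeroSubcomplex.
Variable K : complex.

Fact zero_at_closed n : zmod_closed (pred1 (0 : K n)).
Proof. by split=> [|x y]; rewrite !inE // => /eqP-> /eqP->; rewrite subrr. Qed.
HB.instance Definition _ n :=
  GRing.isZmodClosed.Build (K n) (pred1 (0 : K n)) (zero_at_closed n).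

Fact zero_bd n x : x \in pred1 (0 : K n.+1) -> bd K n x \in pred1 (0 : K n).
Proof. by rewrite !inE => /eqP->; rewrite raddf0. Qed.

Definition zerocx : subcomplex K :=
  @SubComplex K (fun n => pred1 (0 : K n)) zero_bd.

End ZeroSubcomplex.

Section Filtration.
Variables (K : complex) (F : nat -> subcomplex K).

Definition fil_pred (k : nat) : subcomplex K :=
  if k is k'.+1 then F k' else zerocx K.

Definition gr (k : nat) : complex := subquotcx (F k) (fil_pred k).

Hypothesis F_full : forall n (x : K n), x \in F n n.

Lemma bd_pred n (x : K n.+1) : bd K n x \in fil_pred n.+1 n.
Proof. exact: F_full. Qed.

Definition gr_class n (x : K n) : gr n n :=
  \pi_(quotz _) (Subz (F_full x)).

Fact gr_class_additive n : zmod_morphism (@gr_class n).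
Proof. by move=> x y; rewrite /gr_class -raddfB; congr \pi; apply: val_inj. Qed.
HB.instance Definition _ n :=
  GRing.isZmodMorphism.Build (K n) (gr n n) (@gr_class n) (@gr_class_additive n).

Fact gr_class_cycle n (x : K n) : gr_class x \in cycles (gr n) n.
Proof.
case: n x => [|n] x //=; rewrite inE /= quotz_mapE pi_eq0 inE /=.
exact: bd_pred.
Qed.

(* The class in H_n (F_n / F_(n-1)) of a chain of K_n = F_n K_n. *)
Definition diag_class n (x : K n) : homology (gr n) n :=
  homology_class (Subz (gr_class_cycle x)).

Fact diag_class_additive n : zmod_morphism (@diag_class n).
Proof.
move=> x y; rewrite /diag_class -raddfB; congr \pi; apply: val_inj.
by rewrite /= raddfB.
Qed.
HB.instance Definition _ n :=
  GRing.isZmodMorphism.Build (K n) (homology (gr n) n) (@diag_class n)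
    (@diag_class_additive n).

Definition diag_repr n (h : homology (gr n) n) : K n :=
  val (repr (val (repr h))).

Lemma diag_reprK n : cancel (@diag_repr n) (@diag_class n).
Proof.
move=> h; rewrite -[RHS]reprK; congr \pi; apply: val_inj => /=.
by rewrite -[RHS]reprK; congr \pi; apply: val_inj.
Qed.

Lemma diag_class_bd n (x : K n.+1) : diag_class x = 0 -> diag_class (bd K n x) = 0.
Proof.
move=> /eqP; rewrite pi_eq0 inE /= => /asboolP[y].
rewrite -[y]reprK /= quotz_mapE => /eqP; rewrite -subr_eq0.
rewrite /gr_class -raddfB pi_eq0 inE /=.
move: (val (repr y)) => {}y xF.
have wF : x - bd K n.+1 y \in F n n.+1 by rewrite -opprB rpredN.
have -> : bd K n x = bd K n (x - bd K n.+1 y) by rewrite raddfB bdK subr0.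
apply/eqP; rewrite pi_eq0 inE /=; apply/asboolP.
exists (\pi_(quotz _) (Subz wF)); rewrite /= quotz_mapE; congr \pi.
exact: val_inj.
Qed.

(* The differential d_1 : E^1_(n+1,0) -> E^1_(n,0) of the spectral sequence;
   it does not depend on the representing chain, by d1_class. *)
Definition d1 n (h : homology (gr n.+1) n.+1) : homology (gr n) n :=
  diag_class (bd K n (diag_repr h)).

Lemma d1_class n (x : K n.+1) : d1 (diag_class x) = diag_class (bd K n x).
Proof.
apply/eqP; rewrite -subr_eq0 /d1 -!raddfB; apply/eqP/diag_class_bd.
by rewrite raddfB /= diag_reprK subrr.
Qed.

Fact d1_additive n : zmod_morphism (@d1 n).
Proof.
by move=> g h; rewrite -[g]diag_reprK -[h]diag_reprK -raddfB !d1_class !raddfB.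
Qed.
HB.instance Definition _ n :=
  GRing.isZmodMorphism.Build (homology (gr n.+1) n.+1) (homology (gr n) n)
    (@d1 n) (@d1_additive n).

Fact d1K n (h : homology (gr n.+2) n.+2) : d1 (d1 h) = 0.
Proof. by rewrite -[h]diag_reprK !d1_class bdK raddf0. Qed.

Definition diagcx : complex :=
  @Complex (fun n => homology (gr n) n) (fun n => @d1 n) d1K.

End Filtration.

Record sgraph := SGraph {
  vert :> choiceType;
  adj : rel vert;
  adj_sym : symmetric adj;
  adj_irr : irreflexive adj
}.

Definition triangle_free (G : sgraph) : Prop :=
  forall x y z : G, ~~ [&& adj x y, adj y z & adj z x].

Definition graph_map (G H : sgraph) (f : G -> H) : Prop :=
  forall x y, adj x y -> adj (f x) (f y) \/ f x = f y.

Definition cube (n : nat) := {ffun 'I_n -> bool}.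

Definition cube_adj n : rel (cube n) :=
  fun x y => #|[set i | x i != y i]| == 1%N.

Fact cube_adj_sym n : symmetric (@cube_adj n).
Proof.
by move=> x y; congr (_ == _); apply: eq_card => i; rewrite !inE eq_sym.
Qed.

Fact cube_adj_irr n : irreflexive (@cube_adj n).
Proof.
by move=> x; rewrite /cube_adj eq_card0 // => i; rewrite !inE eqxx.
Qed.

Definition cube_graph (n : nat) : sgraph :=
  SGraph (@cube_adj_sym n) (@cube_adj_irr n).

(* The underlying map is a finite function, so that singular cubes have
   extensional (and decidable) equality. *)
Record scube (n : nat) (G : sgraph) := SCube {
  scube_fun :> {ffun cube n -> G};
  scubeP : `[< @graph_map (cube_graph n) G scube_fun >]
}.
HB.instance Definition _ n G := [isSub of scube n G for @scube_fun n G].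
HB.instance Definition _ n G := [Choice of scube n G by <:].

Definition cube_insert n (i : 'I_n.+1) (e : bool) (x : cube n) : cube n.+1 :=
  [ffun j => if unlift i j is Some k then x k else e].

Lemma cube_insert_eq n i e (x : cube n) : cube_insert i e x i = e.
Proof. by rewrite ffunE unlift_none. Qed.

Lemma cube_insert_lift n i e (x : cube n) k : cube_insert i e x (lift i k) = x k.
Proof. by rewrite ffunE liftK. Qed.

Lemma cube_insert_adj n (i : 'I_n.+1) e (x y : cube n) :
  cube_adj x y -> cube_adj (cube_insert i e x) (cube_insert i e y).
Proof.
rewrite /cube_adj => /eqP <-.
rewrite -(card_imset _ (@lift_inj _ i)); apply/eqP/eq_card => j.
rewrite inE; case: (unliftP i j) => [k ->|->].
  by rewrite !cube_insert_lift mem_imset ?inE //; apply: lift_inj.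
rewrite !cube_insert_eq eqxx; apply/esym/imsetP => -[k _ /eqP].
by rewrite (negPf (neq_lift _ _)).
Qed.

Fact face_subproof n (G : sgraph) (i : 'I_n.+1) e (s : scube n.+1 G) :
  `[< @graph_map (cube_graph n) G [ffun x => s (cube_insert i e x)] >].
Proof.
apply/asboolP => x y xy; rewrite !ffunE.
exact/(asboolP _ (scubeP s))/cube_insert_adj.
Qed.

(* Coordinates are numbered from 0: [face i false s] and [face i true s] are
   f_(i+1)^- s and f_(i+1)^+ s, whence the sign (-1) ^+ i.+1 in Qbd_cube. *)
Definition face n (G : sgraph) (i : 'I_n.+1) (e : bool) (s : scube n.+1 G) :
  scube n G := SCube (face_subproof i e s).

Definition degenerate n (G : sgraph) : pred (scube n G) :=
  match n with
  | 0 => pred0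
  | m.+1 => fun s => [exists i, face i false s == face i true s]
  end.

(* A face of the n-cube is given by fixing the coordinates i with c i = Some b
   at the value b; its dimension is the number of free coordinates. *)
Definition in_face n (c : {ffun 'I_n -> option bool}) : {pred cube n} :=
  [pred x : cube n | [forall i, if c i is Some b then x i == b else true]].

Definition face_dim n (c : {ffun 'I_n -> option bool}) : nat :=
  #|[set i | c i == None]|.

Definition degree n (G : sgraph) (s : scube n G) : nat :=
  \max_(c : {ffun 'I_n -> option bool} |
        `[< {in in_face c &, injective s} >]) face_dim c.

Definition cubical_dim (G : sgraph) (d : nat) : Prop :=
  (exists s : scube d G, injective s) /\
  (forall m (s : scube m G), injective s -> (m <= d)%N).

Section FaceLemmas.
Variable G : sgraph.

Lemma bump_swap i j k c c' : bump (bump i j) k = i ->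
  bump i (bump j c) = bump (bump i j) (bump k c') -> c = c'.
Proof. rewrite /bump; lia. Qed.

Lemma face_face n (i : 'I_n.+2) (j k : 'I_n.+1) d e (s : scube n.+2 G) :
  lift (lift i j) k = i ->
  face j e (face i d s) = face k d (face (lift i j) e s).
Proof.
move=> Ek; apply: val_inj; apply/ffunP => x; rewrite !ffunE; congr (s _).
apply/ffunP => a; have Eij : lift i j != i by rewrite eq_sym neq_lift.
case: (unliftP i a) => [b|] ->; last first.
  have := cube_insert_lift (lift i j) e (cube_insert k d x) k.
  by rewrite Ek !cube_insert_eq.
rewrite cube_insert_lift; case: (unliftP j b) => [c|] ->; last first.
  by rewrite !cube_insert_eq.
rewrite cube_insert_lift.
case: (unliftP (lift i j) (lift i (lift j c))) => [b' Eb|/lift_inj/eqP]; last first.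
  by rewrite eq_sym (negPf (neq_lift _ _)).
rewrite Eb cube_insert_lift; case: (unliftP k b') Eb => [c' ->|->]; last first.
  by rewrite Ek => /eqP; rewrite eq_sym (negPf (neq_lift _ _)).
rewrite cube_insert_lift => Eb; congr (x _).
by apply/val_inj/(bump_swap (congr1 val Ek) (congr1 val Eb)).
Qed.

Lemma swap_ex n (i : 'I_n.+2) (j : 'I_n.+1) :
  exists k, lift (lift i j) k = i.
Proof.
case: (unliftP (lift i j) i) => [k Ek|/eqP]; first by exists k.
by rewrite (negPf (neq_lift _ _)).
Qed.

Lemma face_degenerate n (s : scube n.+1 G) i e j :
  face i false s = face i true s -> j != i -> degenerate (face j e s).
Proof.
case: n s i j => [|n] s i j Ei ji; first by rewrite !ord1 in ji.
case: (unliftP j i) ji Ei => [k ->|->]; last by rewrite eqxx.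
move=> _ Ei; apply/existsP; exists k; have [k' Ek'] := swap_ex j k.
by rewrite !(face_face _ _ _ Ek') Ei.
Qed.

Lemma face_degree n (s : scube n.+1 G) i e : (degree (face i e s) <= degree s)%N.
Proof.
apply/bigmax_leqP => c /asboolP cinj.
pose c' : {ffun 'I_n.+1 -> option bool} :=
  [ffun j => if unlift i j is Some k then c k else Some e].
have c'i : c' i = Some e by rewrite ffunE unlift_none.
have c'l k : c' (lift i k) = c k by rewrite ffunE liftK.
suff c'inj : {in in_face c' &, injective s}.
  apply: leq_trans (leq_bigmax_cond _ (asboolT c'inj)).
  rewrite /face_dim -(card_imset _ (@lift_inj _ i)) subset_leq_card //.
  by apply/subsetP => _ /imsetP[k ck ->]; rewrite !inE c'l in ck *.
have in_c' x : x \in in_face c' ->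
    exists2 y, y \in in_face c & x = cube_insert i e y.
  rewrite inE => /forallP xc; exists [ffun k => x (lift i k)].
    by rewrite inE; apply/forallP => k; have:= xc (lift i k); rewrite c'l ffunE.
  apply/ffunP => j; case: (unliftP i j) => [k|] ->.
    by rewrite cube_insert_lift ffunE.
  by have:= xc i; rewrite c'i cube_insert_eq => /eqP.
move=> _ _ /in_c'[x xc ->] /in_c'[y yc ->] Exy.
by congr cube_insert; apply: cinj => //; rewrite !ffunE.
Qed.

Lemma degree_le n (s : scube n G) : (degree s <= n)%N.
Proof.
by apply/bigmax_leqP => c _; apply: leq_trans (max_card _) _; rewrite card_ord.
Qed.

End FaceLemmas.

Section CubicalChains.
Variable G : sgraph.

Definition Qchain (n : nat) : zmodType := {freeg (scube n G) / int}.

Definition Qbd_cube n (s : scube n.+1 G) : Qchain n :=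
  \sum_(i < n.+1) (<< face i false s >> - << face i true s >>) *~ (-1) ^+ i.+1.

Definition Qbd n : Qchain n.+1 -> Qchain n := fglift (@Qbd_cube n).

Fact Qbd_additive n : zmod_morphism (@Qbd n).
Proof. exact: lift_is_additive. Qed.
HB.instance Definition _ n :=
  GRing.isZmodMorphism.Build (Qchain n.+1) (Qchain n) (@Qbd n) (@Qbd_additive n).

Lemma QbdU n (s : scube n.+1 G) : Qbd << s >> = Qbd_cube s.
Proof. by rewrite /Qbd liftU scale1r. Qed.

Lemma Qchain_ind n (S : zmodClosed (Qchain n)) :
  (forall s : scube n G, << s >> \in S) -> forall x, x \in S.
Proof.
move=> HS x; rewrite -[x]freeg_sumE rpred_sum // => s _.
by rewrite -[coeff s x]intz -freegU_mulz rpredMz.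
Qed.

Lemma Qbd_cubeE n (s : scube n.+1 G) :
  Qbd_cube s = \sum_(p : 'I_n.+1 * bool) << face p.1 p.2 s >> *~ (-1) ^+ (p.1 + p.2).+1.
Proof.
rewrite -(pair_bigA _ (fun i e => << face i e s >> *~ (-1) ^+ (i + nat_of_bool e).+1)) /=.
apply: eq_bigr => i _; rewrite big_bool /= addn0 addn1 [in RHS]addrC.
by rewrite mulrzBl [(-1) ^+ i.+2]exprS mulN1r mulrNz.
Qed.

Lemma Qbd_cubeK n (s : scube n.+2 G) : Qbd (Qbd_cube s) = 0.
Proof.
pose P := (('I_n.+2 * bool) * ('I_n.+1 * bool))%type.
pose F (p : P) : Qchain n :=
  << face p.2.1 p.2.2 (face p.1.1 p.1.2 s) >>
    *~ (-1) ^+ (p.1.1 + p.1.2 + p.2.1 + p.2.2).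
have -> : Qbd (Qbd_cube s) = \sum_p F p.
  rewrite Qbd_cubeE raddf_sum /= -(pair_bigA _ (fun a b => F (a, b))) /=.
  apply: eq_bigr => -[i d] _ /=; rewrite raddfMz /= QbdU Qbd_cubeE.
  rewrite mulrz_suml; apply: eq_bigr => -[j e] _ /=; rewrite -mulrzA /F /=.
  by congr (_ *~ _); rewrite -exprD -[LHS]signr_odd -[RHS]signr_odd; congr (_ ^+ nat_of_bool _); lia.
pose sw (i : 'I_n.+2) (j : 'I_n.+1) := odflt j (unlift (lift i j) i).
have swE i j : lift (lift i j) (sw i j) = i.
  by rewrite /sw; case: unliftP => [k //|/eqP]; rewrite (negPf (neq_lift _ _)).
have swK i j : sw (lift i j) (sw i j) = j by rewrite {1}/sw swE liftK.
pose h (p : P) : P := ((lift p.1.1 p.2.1, p.2.2), (sw p.1.1 p.2.1, p.1.2)).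
have hK : involutive h by case=> -[i d] [j e]; rewrite /h /= swE swK.
have Fh p : F (h p) = - F p.
  case: p => -[i d] [j e]; rewrite /F /= -(face_face _ _ _ (swE i j)).
  rewrite -mulrNz; congr (_ *~ _); rewrite -[RHS]mulN1r -exprS.
  have /= E := congr1 val (swE i j); rewrite -[LHS]signr_odd -[RHS]signr_odd.
  by congr (_ ^+ nat_of_bool _); move: E; rewrite /= /bump; lia.
pose R := [pred p : P | (p.2.1 < p.1.1)%N].
rewrite (bigID R) /= [X in _ + X](reindex_inj (inv_inj hK)) /=.
rewrite [X in _ + X](eq_big R (fun p => - F p)) => [|[[i d] [j e]]|//].
  by rewrite sumrN subrr.
move=> /=; have:= congr1 val (swE i j); rewrite /= /bump; lia.
Qed.

Fact QbdK n (x : Qchain n.+2) : Qbd (Qbd x) = 0.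
Proof.
have: x \in kerz (@Qbd n \o @Qbd n.+1); last by rewrite inE => /eqP.
by apply: Qchain_ind => s; rewrite inE /= QbdU Qbd_cubeK.
Qed.

Definition Qcx : complex := @Complex Qchain (fun n => @Qbd n) QbdK.

Definition Dgen n (x : Qcx n) : Prop :=
  exists2 s : scube n G, degenerate s & x = << s >>.

Fact D_bd n (x : Qcx n.+1) : x \in genz (@Dgen n.+1) -> bd Qcx n x \in genz (@Dgen n).
Proof.
move: x; apply: (genz_sub (S := preimz (bd Qcx n) (genz (@Dgen n)))) => _ [s Ds ->].
rewrite inE /= QbdU /Qbd_cube; move: Ds => /existsP[i /eqP Ei].
rewrite rpred_sum // => j _; rewrite rpredMz //.
have [->|ji] := eqVneq j i; first by rewrite Ei subrr rpred0.
have D e : << face j e s >> \in genz (@Dgen n).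
  by apply: mem_genz; exists (face j e s) => //; apply: face_degenerate Ei ji.
by rewrite rpredB.
Qed.

Definition Dcx : subcomplex Qcx :=
  @SubComplex Qcx (fun n => genz (@Dgen n)) D_bd.

Definition Ccx : complex := quotcx Dcx.

Definition Cclass n (s : scube n G) : Ccx n := \pi_(quotz (Dcx n)) << s >>.

Lemma Cclass_degenerate n (s : scube n G) : degenerate s -> Cclass s = 0.
Proof. by move=> Ds; apply/eqP; rewrite pi_eq0 mem_genz //; exists s. Qed.

Definition Cgen k n (x : Ccx n) : Prop :=
  exists2 s : scube n G, ~~ degenerate s && (degree s <= k)%N & x = Cclass s.

Lemma Cclass_in k n (s : scube n G) : (degree s <= k)%N -> Cclass s \in genz (@Cgen k n).
Proof.
move=> sk; have [Ds|Ds] := boolP (degenerate s).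
  by rewrite (Cclass_degenerate Ds) rpred0.
by rewrite mem_genz //; exists s; rewrite ?Ds.
Qed.

Fact C_bd k n (x : Ccx n.+1) :
  x \in genz (@Cgen k n.+1) -> bd Ccx n x \in genz (@Cgen k n).
Proof.
move: x; apply: (genz_sub (S := preimz (bd Ccx n) (genz (@Cgen k n)))) => _ [s + ->].
case/andP=> _ sk; rewrite inE /= quotz_mapE /= QbdU raddf_sum rpred_sum // => i _.
rewrite raddfMz rpredMz // raddfB rpredB //.
all: by apply/Cclass_in/(leq_trans (face_degree _ _ _)).
Qed.

(* C_*^k; the term C_*^(-1) = 0 of the filtration is supplied by [fil_pred]. *)
Definition Cfil (k : nat) : subcomplex Ccx :=
  @SubComplex Ccx (fun n => genz (@Cgen k n)) (C_bd (k := k)).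

Fact Cfil_full n (x : Ccx n) : x \in Cfil n n.
Proof.
rewrite -[x]reprK.
have: repr x \in preimz (\pi_(quotz (Dcx n)) : {additive _ -> Ccx n}) (Cfil n n).
  by apply: Qchain_ind => s; rewrite inE; apply/Cclass_in/degree_le.
by rewrite inE.
Qed.

End CubicalChains.

Definition cubical_homology (G : sgraph) (n : nat) : zmodType :=
  homology (Ccx G) n.

(* H_n^[k](G): the degree k comes before the dimension n. *)
Definition degree_homology (G : sgraph) (k n : nat) : zmodType :=
  homology (gr (Cfil G) k) n.

(* H_0^[0](G) <- H_1^[1](G) <- H_2^[2](G) <- ... with differential d_1. *)
Definition injective_complex (G : sgraph) : complex := diagcx (@Cfil_full G).

(* In dimension 2 this is by definition the quotient of the kernel of
   d_1 : H_2^[2] -> H_1^[1] by the image of d_1 : H_3^[3] -> H_2^[2]. *)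
Definition injective_homology (G : sgraph) (n : nat) : zmodType :=
  homology (injective_complex G) n.

(* Main.v *)
Require Import Defs.
From HB Require Import structures.
From mathcomp.multinomials Require Import freeg.
From mathcomp Require Import all_boot all_algebra.
From mathcomp Require Import zify boolp.

(* The point is that the complex C^1 of cubes of degree at most 1 is acyclic in
   dimensions >= 2; both claims then follow by chasing representatives through
   the filtration.

   In a triangle-free graph a non-injective 2-cube backtracks, so a cube of
   degree at most 1 lifts, uniquely up to the choice of a root, to the universal
   cover, the forest W of reduced walks.  Resolving Z by the vertices and the
   edges of the tree of possible roots gives an exact sequence
     0 -> C(L) --delta--> C(W) -> C^1(G) -> 0,
   where L consists of walks together with an oriented edge at their root, one
   orientation being chosen for every edge.  As W and L
   are forests, they are contractible (move every vertex towards its root), so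
   their chain complexes are acyclic in positive dimensions.  Given a cycle z of
   C^1 in dimension >= 2, let s be its lift rooted at the origins of its cubes:
   the boundary of s is delta k for a cycle k = bd y, hence s - delta y = bd x,
   and z is the boundary of the projection of x. *)

Set Implicit Arguments.
Unset Strict Implicit.
Unset Printing Implicit Defensive.

Import GRing.Theory.
Local Open Scope ring_scope.
Local Open Scope quotient_scope.

(** * Reduced walks *)

Record gmap (G H : sgraph) := GMap {
  gmap_fun :> G -> H;
  gmapP : graph_map gmap_fun
}.

Section ReducedWalks.
Variable G : sgraph.
Implicit Types (x y u v w : G) (q r : seq G).

(* A walk is a pair (x, q): q lists the vertices from the one before the
   endpoint x back to the root, which is last x q. *)
Fixpoint reduced x q : bool :=
  if q is y :: r then [&& adj x y, ohead r != Some x & reduced y r] else true.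

(** One step of path lifting: returning to the previous vertex cancels, any other edge extends the
    walk. Junk: the walk is unchanged if [u] is neither the previous vertex nor a neighbour of
    [x]. *)
Definition stepto x q u : G * seq G :=
  if ohead q == Some u then (u, behead q)
  else if adj u x then (u, x :: q) else (x, q).

(* Moves the root to its neighbour w: the old root is dropped if the walk leaves
   it through w, otherwise w is appended.  Junk: the identity if w is not a
   neighbour of the root. *)
Fixpoint reroot_tail w x q : seq G :=
  if q is y :: r then
    if (r == [::]) && (x == w) then [::] else y :: reroot_tail w y r
  else if adj x w then [:: w] else [::].

(** The neighbour through which the walk leaves its root. Junk: [x] for the trivial walk. *)
Definition next_to_root x q : G := last x (belast x q).

Lemma reduced_stepto x q u :
  reduced x q -> reduced (stepto x q u).1 (stepto x q u).2.
Proof.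
rewrite /stepto; case: eqP => [|/eqP qu].
  by case: q => //= y r [->] /and3P[].
by case: (boolP (adj u x)) => ux //=; rewrite ux qu.
Qed.

(** Only the root end changes, and a [w] that would backtrack there is cancelled instead of
    appended. *)
Lemma reduced_reroot w x q : reduced x q -> reduced x (reroot_tail w x q).
Proof.
elim: q x => [|y r IH] x /=; first by case: (boolP (adj x w)) => //= ->.
case/and3P=> xy rx yr; case: (boolP ((r == [::]) && (x == w))) => //= h.
rewrite xy IH //= andbT; case: r {IH yr} rx h => [|z r] /= rx h.
  by case: (boolP (adj y w)) => //= yw; rewrite eq_sym.
by case: ((r == [::]) && (y == w)) => /=.
Qed.

Lemma last_reroot w x q :
  adj (last x q) w -> last x (reroot_tail w x q) = w.
Proof.
elim: q x => [|y r IH] x /=; first by move=> ->.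
by case: (boolP ((r == [::]) && (x == w))) => //= [/andP[_ /eqP]|_ /IH].
Qed.

Lemma reroot_nonadj w x q :
  reduced x q -> ~~ adj (last x q) w -> reroot_tail w x q = q.
Proof.
elim: q x => [|y r IH] x /=; first by move=> _ /negPf ->.
case/and3P=> xy _ yr nw; case: (boolP ((r == [::]) && (x == w))) => /= [|_].
  by case/andP=> /eqP Er /eqP Ew; rewrite Er -Ew adj_sym xy in nw.
by rewrite IH.
Qed.

Lemma reroot_tailK w x q :
  reduced x q -> adj (last x q) w ->
  reroot_tail (last x q) x (reroot_tail w x q) = q.
Proof.
elim: q x => [|y r IH] x /=; first by move=> _ -> /=; rewrite eqxx.
case/and3P=> xy rx yr aw; case: (boolP ((r == [::]) && (x == w))) => /= h.
  by case/andP: h => /eqP-> _ /=; rewrite xy.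
(* The cancelling test fails here: an empty rerooted tail forces [r] to be the old root alone, and
   the walk [x, y, x] would backtrack. *)
rewrite IH //; case: ifP => // /andP[/eqP Er /eqP Ex]; exfalso.
case: r Er Ex {IH h} rx yr aw => [|z [|z' r]] /=.
- by move=> + _ _ _ aw; rewrite aw.
- by move=> _ ->; rewrite eqxx.
- by [].
Qed.

Lemma size_reroot_next x y r :
  size (reroot_tail (next_to_root x (y :: r)) x (y :: r)) = size r.
Proof.
rewrite /next_to_root; elim: r x y => [|z r IH] x y.
  by rewrite /= eqxx.
by rewrite /= in IH *; rewrite IH.
Qed.

(** Moving the root across an edge either removes that edge from the start of the walk or puts it
    there; [base_path_reroot] splits along this dichotomy. *)
Lemma next_reroot w x q : reduced x q -> adj (last x q) w ->
    (q != [::] /\ next_to_root x q = w) \/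
    (reroot_tail w x q != [::] /\
     next_to_root x (reroot_tail w x q) = last x q).
Proof.
rewrite /next_to_root; elim: q x => [|y r IH] x /=; first by move=> _ ->; right.
case/and3P=> xy rx yr aw; case: (boolP ((r == [::]) && (x == w))) => /= h.
  by case/andP: h => /eqP -> /eqP; left.
have [[rn En]|[rn En]] := IH _ yr aw; [left | right]; split=> //.
by case: r rn En {IH rx yr aw h} => [|z r].
by case: (reroot_tail w y r) rn En.
Qed.

Definition rwalk : Type := {p : G * seq G | reduced p.1 p.2}.
HB.instance Definition _ := SubChoice.on rwalk.
Definition RWalk a (h : reduced a.1 a.2) : rwalk := exist _ a h.
Implicit Types p : rwalk.

Definition whead p : G := (val p).1.
Definition wtail p : seq G := (val p).2.
Definition wroot p : G := last (whead p) (wtail p).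

Lemma rwalk_eq p p' : whead p = whead p' -> wtail p = wtail p' -> p = p'.
Proof.
move=> Eh Et; apply: val_inj; rewrite [LHS]surjective_pairing.
by rewrite [RHS]surjective_pairing; congr (_, _).
Qed.

Definition trivial_walk x : rwalk := @RWalk (x, [::]) isT.

Definition wstep p u : rwalk := RWalk (reduced_stepto u (valP p)).

Definition wreroot w p : rwalk :=
  @RWalk (whead p, reroot_tail w (whead p) (wtail p)) (reduced_reroot w (valP p)).

Fact parent_subproof p :
  let p' := if wtail p is y :: r then (y, r) else val p in reduced p'.1 p'.2.
Proof. by case: p => [[x [|y r]]] //= /and3P[]. Qed.

Definition parent p : rwalk := RWalk (parent_subproof p).

Lemma whead_step p u : adj u (whead p) -> whead (wstep p u) = u.
Proof. by rewrite /whead /= /stepto => ->; case: eqP. Qed.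

Lemma wtail_parent p : wtail (parent p) = behead (wtail p).
Proof. by case: p => [[x [|y r]]]. Qed.

Lemma wroot_parent p : wroot (parent p) = wroot p.
Proof. by case: p => [[x [|y r]]]. Qed.

(** A trivial walk is its own parent, so loops have to be excluded explicitly. *)
Definition wadj : rel rwalk :=
  fun p p' => (p != p') && ((parent p == p') || (parent p' == p)).

Fact wadj_sym : symmetric wadj.
Proof. by move=> p p'; rewrite /wadj eq_sym orbC. Qed.

Fact wadj_irr : irreflexive wadj.
Proof. by move=> p; rewrite /wadj eqxx. Qed.

Definition walk_graph : sgraph := SGraph wadj_sym wadj_irr.

Lemma wadj_cons p p' : wadj p p' ->
  wtail p = whead p' :: wtail p' \/
  wtail p' = whead p :: wtail p.
Proof.
move=> /andP[+ /orP[]/eqP E]; rewrite -{}E.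
  by case: p => [[x [|y r]] h] ne; [case/eqP: ne; apply: val_inj | left].
by case: p' => [[x [|y r]] h] ne; [case/eqP: ne; apply: val_inj | right].
Qed.

Lemma cons_wadj p p' : wtail p' = whead p :: wtail p -> wadj p p'.
Proof.
move=> E; rewrite /wadj; apply/andP; split.
  by apply/eqP => Ep; move: (congr1 size E); rewrite Ep /= => /n_Sn.
apply/orP; right; apply/eqP/rwalk_eq; last by rewrite wtail_parent E.
by rewrite /whead /= E.
Qed.

Lemma reduced_walk p : reduced (whead p) (wtail p).
Proof. exact: valP p. Qed.

Lemma whead_adj p p' : wadj p p' -> adj (whead p) (whead p').
Proof.
move=> /wadj_cons[] E; [have := reduced_walk p | have := reduced_walk p'].
  by rewrite E => /and3P[].
by rewrite E => /and3P[]; rewrite adj_sym.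
Qed.

Lemma wstep_id p : wstep p (whead p) = p.
Proof.
apply: val_inj; rewrite /= /stepto adj_irr -surjective_pairing; case: eqP => //.
rewrite -/(wtail p); have := reduced_walk p.
by case: (wtail p) => //= y r /and3P[+ _ _] [Ey]; rewrite Ey adj_irr.
Qed.

(** Unique lifting of edges: a neighbour of a walk is determined by its endpoint. *)
Lemma wadj_step p p' : wadj p p' \/ p = p' -> p' = wstep p (whead p').
Proof.
case=> [|->]; last by rewrite wstep_id.
case/wadj_cons => E; apply: rwalk_eq.
- by rewrite /whead /= /stepto -/(whead p) -/(wtail p) E eqxx.
- by rewrite /wtail /= /stepto -/(whead p) -/(wtail p) E eqxx.
- have := reduced_walk p'; rewrite E => /= /and3P[a /negPf n _].
  by rewrite [RHS]/whead /= /stepto -/(whead p) -/(wtail p) n a.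
- have := reduced_walk p'; rewrite E => /= /and3P[a /negPf n _].
  by rewrite [RHS]/wtail /= /stepto -/(whead p) -/(wtail p) n a.
Qed.

Lemma wstep_adj p u : wadj p (wstep p u) \/ p = wstep p u.
Proof.
case: (eqVneq (ohead (wtail p)) (Some u)) => [E|n].
  left; rewrite wadj_sym; apply: cons_wadj.
  rewrite /whead /wtail /= /stepto -/(whead p) -/(wtail p) E eqxx /=.
  by case: (wtail p) E => //= y r [->].
case: (boolP (adj u (whead p))) => a.
  left; apply: cons_wadj.
  by rewrite {1}/wtail /= /stepto -/(whead p) -/(wtail p) (negPf n) a.
right; apply: val_inj; rewrite /= /stepto -/(whead p) -/(wtail p).
by rewrite (negPf n) (negPf a) [LHS]surjective_pairing.
Qed.

Lemma whead_wstep p u : adj (whead p) u \/ whead p = u -> whead (wstep p u) = u.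
Proof.
case=> [a|<-]; last by rewrite wstep_id.
by apply: whead_step; rewrite adj_sym.
Qed.

Lemma wstepK p u : adj (whead p) u \/ whead p = u ->
  wstep (wstep p u) (whead p) = p.
Proof.
move=> a; apply/esym/wadj_step.
by have [h|h] := wstep_adj p u; [left; rewrite wadj_sym | right].
Qed.

Lemma wstep_step p u : adj (whead p) u \/ whead p = u ->
  wstep (wstep p u) u = wstep p u.
Proof. by move=> /whead_wstep E; have := wstep_id (wstep p u); rewrite E. Qed.

Lemma wroot_adj p p' : wadj p p' -> wroot p = wroot p'.
Proof. by case/andP=> _ /orP[]/eqP <-; rewrite wroot_parent. Qed.

Lemma parent_near p : wadj p (parent p) \/ p = parent p.
Proof.
rewrite /wadj eqxx; case: (eqVneq p (parent p)) => [|_]; first by right.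
by left.
Qed.

Lemma parent_map : @graph_map walk_graph walk_graph parent.
Proof.
move=> p p' /= /andP[_ /orP[]/eqP E]; rewrite -E; first exact: parent_near.
by have [h|h] := parent_near (parent p'); [left; rewrite wadj_sym | right].
Qed.

Lemma whead_map : @graph_map walk_graph G whead.
Proof. by move=> p p' /whead_adj; left. Qed.

Lemma wreroot_nonadj w p : ~~ adj (wroot p) w -> wreroot w p = p.
Proof.
by move=> n; apply: rwalk_eq; rewrite // {1}/wtail /= reroot_nonadj // reduced_walk.
Qed.

Lemma wroot_reroot w p : adj (wroot p) w -> wroot (wreroot w p) = w.
Proof. exact: last_reroot. Qed.

Lemma wrerootK w p : adj (wroot p) w -> wreroot (wroot p) (wreroot w p) = p.
Proof.
move=> a; apply: rwalk_eq; rewrite // {1}/wtail /=.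
by apply: reroot_tailK => //; apply: reduced_walk.
Qed.

Lemma wreroot_map w : @graph_map walk_graph walk_graph (wreroot w).
Proof.
suff H p p' : wtail p = whead p' :: wtail p' -> adj (wroot p) w ->
    wadj (wreroot w p) (wreroot w p').
  move=> p p' pp'; have [a|n] := boolP (adj (wroot p) w); last first.
    rewrite !wreroot_nonadj -?(wroot_adj pp') //; by left.
  left; case: (wadj_cons pp') => E; first exact: H.
  by rewrite /= wadj_sym H // -(wroot_adj pp').
move=> E a; have := reduced_walk p; rewrite E => /= /and3P[xy _ _].
have Et : wtail (wreroot w p) =
   if (wtail p' == [::]) && (whead p == w) then [::]
   else whead p' :: wtail (wreroot w p').
  by rewrite {1}/wtail /= E.
(* Exceptional case: the one-edge walk [p] becomes trivial while the trivial walk [p'] gains an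
   edge, so parent and child trade places. *)
move: Et; case: ifP => [/andP[/eqP Er /eqP Ew] Et|_ Et].
  apply: cons_wadj; rewrite Et {1}/wtail /= Er /=.
  by rewrite adj_sym -Ew xy.
by rewrite wadj_sym; apply: cons_wadj.
Qed.

Hypothesis tfG : triangle_free G.

(* A closed walk of length 4 with a repeated vertex in a triangle-free graph
   backtracks completely, hence acts trivially on reduced walks. *)
Lemma wstep_square p b c d : let a := whead p in
    adj a b \/ a = b -> adj a c \/ a = c ->
    adj b d \/ b = d -> adj c d \/ c = d -> ~~ uniq [:: a; b; c; d] ->
  wstep (wstep p b) d = wstep (wstep p c) d.
Proof.
move=> a ab ac bd cd nu.
(* The one use of triangle-freeness. *)
have tri x y z : adj x y \/ x = y -> adj y z \/ y = z -> adj x z \/ x = z ->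
    [\/ x = y, y = z | x = z].
  case=> [xy|->]; last by constructor 1.
  case=> [yz|->]; last by constructor 2.
  case=> [xz|->]; last by constructor 3.
  by have := tfG x y z; rewrite xy yz adj_sym xz.
suff [E|E|[E1 E2]|[E1 E2]] : [\/ a = d, b = c, a = b /\ c = d | a = c /\ b = d].
- by rewrite -E !wstepK.
- by rewrite E.
- by rewrite -E1 wstep_id E2 wstep_step // -E2.
- by rewrite -E1 wstep_id -E2 wstep_step.
move: nu; rewrite /= !inE !negb_and !negb_or orbF !negb_and !negbK -!orbA.
case/orP=> [/eqP E|/orP[/eqP E|/orP[/eqP E|/orP[/eqP E|/orP[/eqP E|/eqP E]]]]].
- rewrite -E in bd.
  by case: (tri _ _ _ ac cd bd) => Ed;
    [constructor 2; rewrite -E | constructor 3 | constructor 1].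
- rewrite -E in cd.
  by case: (tri _ _ _ ab bd cd) => Ed;
    [constructor 2; rewrite -Ed | constructor 4 | constructor 1].
- by constructor 1.
- by constructor 2.
- rewrite -E in cd.
  by case: (tri _ _ _ ac cd ab) => Ed;
    [constructor 4 | constructor 2 | constructor 1; rewrite Ed E].
- rewrite -E in bd.
  by case: (tri _ _ _ ab bd ac) => Ed;
    [constructor 3 | constructor 2 | constructor 1; rewrite Ed E].
Qed.
End ReducedWalks.

(** * Cubes of degree at most 1 and their lifts *)

Definition origin n : cube n := [ffun=> false].

Definition flip n (i : 'I_n) (x : cube n) : cube n :=
  [ffun k => x k (+) (k == i)].

Lemma flipK n (i : 'I_n) : involutive (flip i).
Proof. by move=> x; apply/ffunP => k; rewrite !ffunE -addbA addbb addbF. Qed.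

Lemma flipC n (i j : 'I_n) x : flip i (flip j x) = flip j (flip i x).
Proof. by apply/ffunP => k; rewrite !ffunE addbAC. Qed.

Lemma cube_adj_flip n (i : 'I_n) (x : cube n) : cube_adj x (flip i x).
Proof.
rewrite /cube_adj -(cards1 i); apply/eqP/eq_card => k; rewrite !inE ffunE.
by case: (x k) (k == i) => [] [].
Qed.

Lemma cube_adjP n (x y : cube n) : cube_adj x y -> exists i, y = flip i x.
Proof.
move=> /cards1P[i /setP E]; exists i; apply/ffunP => k; rewrite ffunE.
by have := E k; rewrite !inE; case: (x k) (y k) (k == i) => [] [] [].
Qed.

(** Induction on the number of coordinates equal to 1. It spreads lifts, roots and labels from the
    origin over a whole cube. *)
Lemma cube_ind n (P : cube n -> Prop) :
  P (origin n) -> (forall i x, P x -> P (flip i x)) -> forall x, P x.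
Proof.
move=> P0 PS x; have [m le_m] := ubnP #|[set i | x i]|.
elim: m x le_m => // m IH x le_m; case: (pickP (fun i => x i)) => [i xi|x0].
  rewrite -[x](flipK i); apply/PS/IH; move: le_m; rewrite (cardsD1 i) inE xi add1n ltnS.
  apply: leq_trans; rewrite ltnS; apply/subset_leq_card/subsetP => k.
  by rewrite !inE ffunE; case: eqP => [->|_]; rewrite ?xi ?addbF.
by suff -> : x = origin n by []; apply/ffunP => i; rewrite x0 ffunE.
Qed.

Lemma uniq_square n (i j : 'I_n) (x : cube n) : i != j ->
  uniq [:: x; flip i x; flip j x; flip i (flip j x)].
Proof.
move=> ij; have ji : j != i by rewrite eq_sym.
have ne (y z : cube n) (k : 'I_n) : y k != z k -> y != z.
  by apply: contraNneq => ->.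
rewrite /= !inE !negb_or andbT; apply/and3P; split.
- apply/and3P; split; [apply: (ne _ _ i) | apply: (ne _ _ j) | apply: (ne _ _ i)].
  + by rewrite !ffunE eqxx; case: (x i).
  + by rewrite !ffunE eqxx; case: (x j).
  + by rewrite !ffunE eqxx (negPf ij); case: (x i).
- apply/andP; split; [apply: (ne _ _ i) | apply: (ne _ _ j)].
  + by rewrite !ffunE eqxx (negPf ij); case: (x i).
  + by rewrite !ffunE eqxx (negPf ji); case: (x j).
- by apply: (ne _ _ i); rewrite !ffunE eqxx (negPf ij); case: (x i).
Qed.

Lemma cube_insert_flip n (i : 'I_n.+1) e (j : 'I_n) x :
  cube_insert i e (flip j x) = flip (lift i j) (cube_insert i e x).
Proof.
apply/ffunP => k; rewrite [RHS]ffunE; case: (unliftP i k) => [l|] ->.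
  by rewrite !cube_insert_lift ffunE (inj_eq lift_inj).
by rewrite !cube_insert_eq (negPf (neq_lift _ _)) addbF.
Qed.

Lemma flip_cube_insert n (i : 'I_n.+1) e x :
  flip i (cube_insert i e x) = cube_insert i (~~ e) x.
Proof.
apply/ffunP => k; rewrite [LHS]ffunE; case: (unliftP i k) => [l|] ->.
  by rewrite !cube_insert_lift eq_sym (negPf (neq_lift _ _)) addbF.
by rewrite !cube_insert_eq eqxx addbT.
Qed.

Lemma cube_insert_origin n (i : 'I_n.+1) : cube_insert i false (origin n) = origin n.+1.
Proof.
by apply/ffunP => k; rewrite !ffunE; case: unliftP => // j _; rewrite ffunE.
Qed.

Definition forget0 n (x : cube n.+1) : cube n := [ffun j => x (lift ord0 j)].

Lemma forget0_insert n e (x : cube n) : forget0 (cube_insert ord0 e x) = x.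
Proof. by apply/ffunP => k; rewrite ffunE cube_insert_lift. Qed.

Lemma cube_insert_forget0 n (x : cube n.+1) : cube_insert ord0 (x ord0) (forget0 x) = x.
Proof.
apply/ffunP => k; case: (unliftP ord0 k) => [l|] ->.
  by rewrite cube_insert_lift ffunE.
by rewrite cube_insert_eq.
Qed.

Lemma forget0_insertS n (i : 'I_n.+1) e (x : cube n.+1) :
  forget0 (cube_insert (lift ord0 i) e x) = cube_insert i e (forget0 x).
Proof.
apply/ffunP => k; rewrite ffunE; case: (unliftP i k) => [l|] ->; last first.
  by rewrite !cube_insert_eq.
rewrite cube_insert_lift [RHS]ffunE.
have -> : lift ord0 (lift i l) = lift (lift ord0 i) (lift ord0 l).
  by apply: val_inj; rewrite /= /bump; lia.
by rewrite cube_insert_lift.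
Qed.

Lemma cube_insertS0 n (i : 'I_n.+1) e (x : cube n.+1) :
  cube_insert (lift ord0 i) e x ord0 = x ord0.
Proof.
have E : ord0 = lift (lift ord0 i) ord0 by apply: val_inj; rewrite /= /bump; lia.
by have := cube_insert_lift (lift ord0 i) e x ord0; rewrite -E.
Qed.

(** * Cubes without injective squares *)

Section SingularCubes.
Variable G : sgraph.

Lemma scube_near n (s : scube n G) x i :
  adj (s x) (s (flip i x)) \/ s x = s (flip i x).
Proof. exact/(asboolP _ (scubeP s))/cube_adj_flip. Qed.

Lemma flip_scube n (f : cube n -> G) :
  (forall x i, adj (f x) (f (flip i x)) \/ f x = f (flip i x)) ->
  `[< @graph_map (cube_graph n) G [ffun x => f x] >].
Proof.
move=> H; apply/asboolP => x y /cube_adjP[i ->]; rewrite !ffunE; exact: H.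
Qed.

Lemma scube_eq n (s t : scube n G) : s =1 t -> s = t.
Proof. by move=> E; apply: val_inj; apply/ffunP. Qed.

Lemma faceE n i e (s : scube n.+1 G) x : face i e s x = s (cube_insert i e x).
Proof. by rewrite ffunE. Qed.

(** For [i = j] the vertex [x] occurs twice, so only genuine 2-faces are constrained. *)
Definition flat n (s : scube n G) : Prop := forall x i j,
  ~~ uniq [:: s x; s (flip i x); s (flip j x); s (flip i (flip j x))].

Lemma flat_face n i e (s : scube n.+1 G) : flat s -> flat (face i e s).
Proof. by move=> fs x j k; rewrite !faceE !cube_insert_flip. Qed.

(** A square with four distinct values is an injective 2-face; conversely, two free coordinates of
    an injective face span such a square. *)
Lemma degree_le1P n (s : scube n G) : (degree s <= 1)%N <-> flat s.
Proof.
split=> [ds x i j|fs].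
  apply/negP => u; have [ij|ij] := eqVneq i j.
    by move: u; rewrite ij flipK /= !inE eqxx !orbT.
  move: ds; rewrite leqNgt => /negP; apply.
  pose c : {ffun 'I_n -> option bool} :=
    [ffun k => if k \in [set i; j] then None else Some (x k)].
  pose sq := [:: x; flip i x; flip j x; flip i (flip j x)].
  have in_sq y : y \in in_face c -> y \in sq.
    rewrite inE => /forallP yc.
    (* Off [i] and [j] the vertex [y] agrees with [x], so it arises from [x] by flipping some of
       these two coordinates. *)
    pose y' : cube n := [ffun k => x k (+) ((k == i) && (y i != x i))
                                       (+) ((k == j) && (y j != x j))].
    have -> : y = y'.
      apply/ffunP => k; have := yc k; rewrite !ffunE !inE.
      case: (eqVneq k i) => [->|_] /=.
        by move=> _; rewrite (negPf ij) addbF; case: (y i) (x i) => [] [].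
      case: (eqVneq k j) => [->|_] /=; last by move=> /eqP ->; rewrite !addbF.
      by move=> _; rewrite addbF; case: (y j) (x j) => [] [].
    have : y' = iter (y i != x i) (flip i) (iter (y j != x j) (flip j) x).
      apply/ffunP => k; rewrite !ffunE.
      case: (y i != x i) (y j != x j) => [] [] /=;
        by rewrite ?ffunE ?andbT ?andbF ?addbF // addbAC.
    move=> ->; rewrite !inE; case: (y i != x i) (y j != x j) => [] [] /=;
      by rewrite eqxx ?orbT.
  have cinj : {in in_face c &, injective s}.
    move=> y z /in_sq yS /in_sq zS E.
    move: u; rewrite -/(map s sq) => u.
    apply/eqP/negPn/negP => yz.
    have /(nthP x)[a la Ea] := yS; have /(nthP x)[b lb Eb] := zS.
    have := @nth_uniq _ (s x) (map s sq) a b.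
    rewrite size_map => /(_ la lb u); rewrite !(nth_map x) // Ea Eb E eqxx.
    by move/esym/eqP => ab; rewrite -Ea -Eb ab eqxx in yz.
  apply: leq_trans (leq_bigmax_cond _ (asboolT cinj)).
  have <- : #|[set i; j]| = 2%N by rewrite cards2 ij.
  by apply/subset_leq_card/subsetP => k kij; rewrite !inE ffunE kij.
apply/bigmax_leqP => c /asboolP cinj; rewrite leqNgt; apply/negP.
case/card_gt1P => i [j [ci cj ij]]; rewrite !inE in ci cj.
pose x : cube n := [ffun k => if c k is Some b then b else false].
have xc : x \in in_face c.
  by rewrite inE; apply/forallP => k; rewrite ffunE; case: (c k).
have fc y k : c k == None -> y \in in_face c -> flip k y \in in_face c.
  move=> /eqP ck; rewrite !inE => /forallP yc; apply/forallP => l.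
  have := yc l; rewrite ffunE; case: (eqVneq l k) => [->|_]; first by rewrite ck.
  by rewrite addbF.
have := fs x i j; rewrite -/(map s [:: x; flip i x; flip j x; flip i (flip j x)]).
rewrite map_inj_in_uniq.
  by rewrite uniq_square.
suff sub y : y \in [:: x; flip i x; flip j x; flip i (flip j x)] -> y \in in_face c.
  by move=> y z /sub yc /sub zc; apply: cinj.
rewrite !in_cons in_nil orbF => /or4P[] /eqP -> //; apply: (fc) => //; exact: (fc).
Qed.

End SingularCubes.

(** * Composition with graph maps, and prisms between neighbouring maps *)

Section Composition.
Variables (G H : sgraph).
Implicit Types f g : gmap G H.

Fact scomp_subproof f n (s : scube n G) :
  `[< @graph_map (cube_graph n) H [ffun x => f (s x)] >].
Proof.
apply: flip_scube => x i; have [h|->] := scube_near s x i; last by right.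
exact: gmapP h.
Qed.

Definition scomp f n (s : scube n G) : scube n H := SCube (scomp_subproof f s).

Lemma scompE f n (s : scube n G) x : scomp f s x = f (s x).
Proof. by rewrite ffunE. Qed.

Lemma face_scomp f n i e (s : scube n.+1 G) :
  face i e (scomp f s) = scomp f (face i e s).
Proof. by apply: scube_eq => x; rewrite !(faceE, scompE). Qed.

Lemma degenerate_scomp f n (s : scube n G) : degenerate s -> degenerate (scomp f s).
Proof.
case: n s => // n s /existsP[i /eqP E]; apply/existsP; exists i.
by rewrite !face_scomp E.
Qed.

Variables (f g : gmap G H).
Hypothesis near_fg : forall x, adj (f x) (g x) \/ f x = g x.

Fact prism_subproof n (s : scube n G) :
  `[< @graph_map (cube_graph n.+1) H
      [ffun x : cube n.+1 => if x ord0 then g (s (forget0 x)) else f (s (forget0 x))] >].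
Proof.
apply: (flip_scube (n := n.+1)) => x i; rewrite -[x]cube_insert_forget0.
move: (x ord0) (forget0 x) => e {}x; case: (unliftP ord0 i) => [j|] ->.
  rewrite -cube_insert_flip !cube_insert_eq !forget0_insert.
  have [h|->] := scube_near s x j; last by right.
  by case: e; exact: gmapP h.
rewrite flip_cube_insert !cube_insert_eq !forget0_insert.
case: e => /=; last exact: near_fg.
by have [h|->] := near_fg (s x); [left; rewrite adj_sym | right].
Qed.

Definition prism n (s : scube n G) : scube n.+1 H := SCube (prism_subproof s).

Lemma prism_face0 n (s : scube n G) e :
  face ord0 e (prism s) = if e then scomp g s else scomp f s.
Proof.
apply: scube_eq => x; rewrite faceE ffunE cube_insert_eq forget0_insert.
by case: e; rewrite scompE.
Qed.

Lemma prism_faceS n (s : scube n.+1 G) i e :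
  face (lift ord0 i) e (prism s) = prism (face i e s).
Proof.
apply: scube_eq => x; rewrite faceE [LHS]ffunE [RHS]ffunE cube_insertS0 forget0_insertS.
by rewrite !faceE.
Qed.

Lemma degenerate_prism n (s : scube n G) : degenerate s -> degenerate (prism s).
Proof.
case: n s => // n s /existsP[i /eqP E]; apply/existsP; exists (lift ord0 i).
by rewrite !prism_faceS E.
Qed.
End Composition.

(** * Lifting cubes to the forest of reduced walks *)

Section Lifting.
Variable G : sgraph.
Local Notation W := (walk_graph G).

Definition head_gmap : gmap W G := GMap (@whead_map G).

Lemma scube_wstep n (s : scube n W) x i :
  s (flip i x) = wstep (s x) (whead (s (flip i x))).
Proof. exact: wadj_step (scube_near s x i). Qed.

(** By [scube_wstep] the values spread from the origin, one flip at a time. *)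
Lemma lift_unique n (s t : scube n W) :
  scomp head_gmap s = scomp head_gmap t -> s (origin n) = t (origin n) -> s = t.
Proof.
move=> E E0; apply: scube_eq; apply: cube_ind => // i x Ex.
rewrite [LHS]scube_wstep [RHS]scube_wstep Ex.
by have := scompE head_gmap s (flip i x); rewrite E scompE /= => ->.
Qed.

(** Along an edge of the forest the length changes by exactly 1. In a square with distinct
    endpoints, a longest walk would have both its neighbours as parent; these are opposite corners,
    so their endpoints would agree. *)
Lemma flat_head n (s : scube n W) : flat (scomp head_gmap s).
Proof.
move=> x i j; rewrite !scompE /=; apply/negP => u.
pose p := s x; pose q := s (flip i x); pose q' := s (flip j x).
pose r := s (flip i (flip j x)).
have adjW y k : whead (s y) != whead (s (flip k y)) -> wadj (s y) (s (flip k y)).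
  by have [//|->] := scube_near s y k; rewrite eqxx.
move: u; rewrite /= !inE !negb_or => /and4P[/and3P[pq pq' pr] /andP[qq' qr] q'r _].
have /wadj_cons pqA := adjW _ _ pq.
have /wadj_cons pq'A := adjW _ _ pq'.
have /wadj_cons qrA : wadj q r.
  by rewrite /q /r flipC; apply: adjW; rewrite flipC.
have /wadj_cons q'rA : wadj q' r.
  exact: adjW.
move: pqA pq'A qrA q'rA; rewrite -/p -/q -/q' -/r.
have {}pr : whead p <> whead r by apply/eqP.
have {}qq' : whead q <> whead q' by apply/eqP.
move: (p) (q) (q') (r) pr qq' => {}p {}q {}q' {}r pr qq'.
move=> [E1|E1] [E2|E2] [E3|E3] [E4|E4]; try congruence.
all: move: (congr1 size E1) (congr1 size E2) (congr1 size E3) (congr1 size E4).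
all: rewrite /=; lia.
Qed.

Hypothesis tfG : triangle_free G.

(** Induction on the dimension: the face at 0 in direction 0 is lifted first, then every vertex is
    moved by [wstep] in that direction. *)
Lemma lift_exists n (s : scube n G) : flat s ->
  exists t : scube n W,
    scomp head_gmap t = s /\ t (origin n) = trivial_walk (s (origin n)).
Proof.
elim: n s => [|n IH] s fs.
  have H : `[< @graph_map (cube_graph 0) W [ffun x => trivial_walk (s x)] >].
    by apply: flip_scube => x [].
  exists (SCube H); rewrite ffunE; split=> //.
  by apply: scube_eq => x; rewrite scompE ffunE.
have [t [Et Et0]] := IH _ (flat_face ord0 false fs).
have ht y : whead (t y) = s (cube_insert ord0 false y).
  by rewrite -faceE -Et scompE.
pose f (x : cube n.+1) : W := 
  if x ord0 then wstep (t (forget0 x)) (s x) else t (forget0 x).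
have H : `[< @graph_map (cube_graph n.+1) W [ffun x => f x] >].
  apply: flip_scube => x i; rewrite -[x]cube_insert_forget0.
  move: (x ord0) (forget0 x) => e {}x; case: (unliftP ord0 i) => [j|] ->; last first.
    rewrite flip_cube_insert /f !cube_insert_eq !forget0_insert.
    case: e => /=; last exact: wstep_adj.
    by have [h|h] := wstep_adj (t x) (s (cube_insert ord0 true x));
       [left; rewrite wadj_sym | right].
  rewrite -cube_insert_flip /f !cube_insert_eq !forget0_insert.
  case: e; last exact: scube_near.
  rewrite [t (flip j x)]scube_wstep (ht (flip j x)) !cube_insert_flip.
  set X := cube_insert ord0 false x in ht *; set k := lift ord0 j.
  have -> : cube_insert ord0 true x = flip ord0 X by rewrite flip_cube_insert.
  (* Both ways around the square in directions 0 and [j] give the same lift, so the lifts on the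
     opposite face are one step apart. *)
  rewrite -(@wstep_square G tfG (t x) (s (flip ord0 X))) ?ht ?(flipC k).
  - exact: wstep_adj.
  - exact: scube_near.
  - exact: scube_near.
  - by rewrite flipC; exact: scube_near.
  - exact: scube_near.
  - exact: fs.
exists (SCube H); rewrite ffunE /f; split; last first.
  by rewrite -(cube_insert_origin ord0) cube_insert_eq forget0_insert Et0 faceE.
apply: scube_eq => x; rewrite scompE ffunE /f /= -[x]cube_insert_forget0.
move: (x ord0) (forget0 x) => e {}x; rewrite cube_insert_eq forget0_insert.
case: e; last by rewrite ht.
rewrite whead_wstep // ht -(flip_cube_insert ord0 false).
exact: scube_near.
Qed.
End Lifting.

(** * Chain maps and prisms *)

Section ChainLift.
Variables (G : sgraph) (n : nat).

(** The classes of nondegenerate cubes generate the chain group, by [Cfil_full]; classical truth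
    makes [P] a subgroup. *)
Lemma Cchain_ind (P : Ccx G n -> Prop) :
    P 0 -> (forall x y, P x -> P y -> P (x - y)) ->
    (forall s : scube n G, ~~ degenerate s -> P (Cclass s)) ->
  forall x, P x.
Proof.
move=> P0 PB PC x; have := Cfil_full x; rewrite inE => /asboolP.
pose S : {pred Ccx G n} := [pred x | `[< P x >]].
have Sc : zmod_closed S.
  split; first by rewrite inE; apply/asboolP.
  by move=> y z; rewrite !inE => /asboolP Py /asboolP Pz; apply/asboolP/PB.
pose S' : zmodClosed _ := HB.pack S (GRing.isZmodClosed.Build _ S Sc).
move=> /(_ S'); rewrite inE => H; apply/asboolP/H => y [s /andP[sd _] ->].
by rewrite inE; apply/asboolP/PC.
Qed.

Variables (A : zmodType) (phi : scube n G -> A).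

(** Forcing the value 0 on degenerate cubes lets every [phi] descend to the quotient; [CliftE]
    states when nothing was altered. *)
Let phi0 (s : scube n G) : zmodule A := if degenerate s then 0 else phi s.

Definition Clift (x : Ccx G n) : A := fglift phi0 (repr x).

Lemma Clift_pi (x : Qchain G n) : Clift (\pi_(quotz (Dcx G n)) x) = fglift phi0 x.
Proof.
pose f : {additive Qchain G n -> A} :=
  HB.pack (fglift phi0 : Qchain G n -> A)
    (GRing.isZmodMorphism.Build (Qchain G n) A (fglift phi0) (lift_is_additive phi0)).
have fD (y : Qchain G n) : y \in Dcx G n -> f y = 0.
  move=> yD; suff: y \in kerz f by rewrite inE => /eqP.
  move: y yD; apply: genz_sub => _ [s Ds ->].
  by rewrite inE /= liftU scale1r /phi0 Ds.
apply/eqP; rewrite -[Clift _]/(f (repr _)) -[fglift _ _]/(f x) -subr_eq0 -raddfB.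
by rewrite fD // -pi_eq0 raddfB /= reprK subrr.
Qed.

Fact Clift_additive : zmod_morphism Clift.
Proof.
move=> x y; rewrite -[x]reprK -[y]reprK -raddfB !Clift_pi.
exact: (lift_is_additive phi0).
Qed.
HB.instance Definition _ :=
  GRing.isZmodMorphism.Build (Ccx G n) A Clift Clift_additive.

Lemma CliftE (s : scube n G) :
  (degenerate s -> phi s = 0) -> Clift (Cclass s) = phi s.
Proof.
by rewrite /Cclass Clift_pi liftU scale1r /phi0; case: ifP => // _ ->.
Qed.
End ChainLift.

Lemma additive_ext G n (A : zmodType) (f g : {additive Ccx G n -> A}) :
  (forall s : scube n G, ~~ degenerate s -> f (Cclass s) = g (Cclass s)) -> f =1 g.
Proof.
move=> E; apply: Cchain_ind => [|x y Ex Ey|//]; first by rewrite !raddf0.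
by rewrite !raddfB Ex Ey.
Qed.

Lemma bd_Cclass G n (s : scube n.+1 G) : bd (Ccx G) n (Cclass s) =
  \sum_(i < n.+1)
     (Cclass (face i false s) - Cclass (face i true s)) *~ (-1) ^+ i.+1.
Proof.
rewrite /= quotz_mapE /= QbdU raddf_sum; apply: eq_bigr => i _.
by rewrite raddfMz raddfB.
Qed.

Section ChainMaps.
Variables (G H : sgraph).

Definition push (f : gmap G H) n : {additive Ccx G n -> Ccx H n} :=
  Clift (fun s => Cclass (scomp f s)).

Lemma push_class f n (s : scube n G) : push f n (Cclass s) = Cclass (scomp f s).
Proof.
by apply: CliftE => ds; apply/Cclass_degenerate/degenerate_scomp.
Qed.

Lemma push_bd f n x : push f n (bd (Ccx G) n x) = bd (Ccx H) n (push f n.+1 x).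
Proof.
apply: (additive_ext (f := push f n \o bd (Ccx G) n)
                     (g := bd (Ccx H) n \o push f n.+1)) => s _ /=.
rewrite push_class !bd_Cclass raddf_sum; apply: eq_bigr => i _.
by rewrite raddfMz raddfB /= !push_class !face_scomp.
Qed.

Variables (f g : gmap G H).
Hypothesis near_fg : forall x, adj (f x) (g x) \/ f x = g x.

Definition prism_chain n : {additive Ccx G n -> Ccx H n.+1} :=
  Clift (fun s => Cclass (prism near_fg s)).

Lemma prism_class n (s : scube n G) :
  prism_chain n (Cclass s) = Cclass (prism near_fg s).
Proof.
by apply: CliftE => ds; apply/Cclass_degenerate/degenerate_prism.
Qed.

(** The faces in the prism direction 0 give the two pushes. The others are prisms over faces with
    index shifted by one, whence the sign of the last term. *)
Lemma prism_bd n (x : Ccx G n.+1) :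
  bd (Ccx H) n.+1 (prism_chain n.+1 x) =
  push g n.+1 x - push f n.+1 x - prism_chain n (bd (Ccx G) n x).
Proof.
apply: (additive_ext (f := bd (Ccx H) n.+1 \o prism_chain n.+1)
  (g := (push g n.+1 \- push f n.+1) \- (prism_chain n \o bd (Ccx G) n))) => s _ /=.
rewrite prism_class !bd_Cclass big_ord_recl !push_class !prism_face0.
rewrite expr1 mulrN1z opprB; congr (_ + _).
rewrite raddf_sum -sumrN; apply: eq_bigr => i _ /=.
rewrite raddfMz raddfB /= !prism_class !prism_faceS.
by rewrite [in LHS]exprS mulN1r mulrNz.
Qed.
End ChainMaps.

Definition id_gmap G : gmap G G :=
  @GMap G G id (fun x y (h : adj x y) => or_introl h).

Lemma push_id G n x : push (id_gmap G) n x = x.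
Proof.
apply: (additive_ext (f := push (id_gmap G) n) (g := idfun)) => s _ /=.
by rewrite push_class; congr Cclass; apply: scube_eq => y; rewrite scompE.
Qed.

(** * Acyclicity of graphs contracted towards roots *)

Section Contraction.
Variables (F : sgraph) (c : gmap F F) (rk : F -> nat) (rt : F -> F).
Hypothesis near_c : forall x, adj x (c x) \/ x = c x.
Hypothesis iter_c : forall x m, (rk x <= m)%N -> iter m c x = rt x.
Hypothesis rt_adj : forall x y, adj x y -> rt x = rt y.

(** Prisms make [c] homotopic to the identity, while enough iterations of [c] send each cube of
    positive dimension to a degenerate one. *)
Lemma contraction_acyclic n (z : Ccx F n.+1) :
  bd (Ccx F) n z = 0 -> exists y, bd (Ccx F) n.+1 y = z.
Proof.
move=> z0.
pose C m := iter m (push c n.+1).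
have C0 m : C m 0 = 0 by elim: m => //= m ->; rewrite raddf0.
have CB m x y : C m (x - y) = C m x - C m y by elim: m => //= m ->; rewrite raddfB.
have CZ m : bd (Ccx F) n (C m z) = 0 
  by elim: m => [//|m E]; rewrite -[C _ _]/(push c n.+1 (C m z)) -push_bd E raddf0.
have [m Cm] : exists m, C m z = 0.
  move: z {z0 CZ}; apply: Cchain_ind => [|x y [a Ea] [b Eb]|s _]; first by exists 0.
    exists (a + b)%N; rewrite CB {1}addnC /C !iterD -!/(C _ _) Ea Eb !C0 subr0 //.
  (* After as many iterations as the largest rank on the cube, all vertices sit at their roots, and
     adjacent vertices share a root. *)
  pose m := \max_(x : cube n.+1) rk (s x); exists m.
  have E k : exists2 t : scube n.+1 F,
      C k (Cclass s) = Cclass t & forall x, t x = iter k c (s x).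
    elim: k => [|k [t Et tE]]; first by exists s.
    by exists (scomp c t); rewrite /= ?Et ?push_class // => x; rewrite scompE tE.
  have [t -> tE] := E m; apply: Cclass_degenerate; apply/existsP; exists ord0.
  have tr x : t x = rt (s x) by rewrite tE iter_c // /m (leq_bigmax x).
  apply/eqP/scube_eq => x; rewrite !faceE !tr -[true]/(~~ false) -flip_cube_insert.
  have [h|->//] := scube_near s (cube_insert ord0 false x) ord0.
  exact: rt_adj.
(* Summing the prisms over the successive iterates telescopes. *)
suff {m Cm} H m : exists y, bd (Ccx F) n.+1 y = C m z - z.
  by have [y] := H m; rewrite Cm sub0r => E; exists (- y); rewrite raddfN E opprK.
elim: m => [|m [y Ey]]; first by exists 0; rewrite raddf0 subrr.
exists (y + prism_chain (f := id_gmap F) near_c n.+1 (C m z)).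
rewrite raddfD Ey prism_bd CZ raddf0 subr0 push_id -[C m.+1 _]/(push c n.+1 (C m z)).
by rewrite addrC addrA subrK.
Qed.
End Contraction.

(** * Acyclicity of C^1 *)

Section Covering.
Variable G : sgraph.
Local Notation W := (walk_graph G).

Definition parent_gmap : gmap W W := GMap (@parent_map G).
Definition reroot_gmap w : gmap W W := GMap (@wreroot_map G w).

Lemma iter_parent (p : rwalk G) m :
  (size (wtail p) <= m)%N -> iter m (@parent G) p = trivial_walk (wroot p).
Proof.
elim: m p => [|m IH] p h.
  move: h; rewrite leqn0 size_eq0 => /eqP E; apply: rwalk_eq; last by rewrite E.
  by rewrite /wroot E.
rewrite iterSr IH; first by rewrite wroot_parent.
by rewrite wtail_parent size_behead -subn1 leq_subLR.
Qed.

Lemma walk_acyclic n (z : Ccx W n.+1) :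
  bd (Ccx W) n z = 0 -> exists y, bd (Ccx W) n.+1 y = z.
Proof.
apply: (contraction_acyclic (c := parent_gmap) (rk := fun p => size (wtail p))
         (rt := fun p => trivial_walk (wroot p))).
- exact: parent_near.
- exact: iter_parent.
- by move=> x y /wroot_adj ->.
Qed.

(* A label stands for the edge from the root to it; labels that are not adjacent
   to the root are allowed, but normalize kills them. *)
Definition ladj : rel (rwalk G * G) :=
  fun a b => (a.2 == b.2) && wadj a.1 b.1.

Fact ladj_sym : symmetric ladj.
Proof. by move=> a b; rewrite /ladj wadj_sym eq_sym. Qed.

Fact ladj_irr : irreflexive ladj.
Proof. by move=> a; rewrite /ladj wadj_irr andbF. Qed.

Definition labeled_graph : sgraph := SGraph ladj_sym ladj_irr.
Local Notation L := labeled_graph.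

Fact label_map w : @graph_map W L (fun p => (p, w)).
Proof. by move=> p q pq; left; rewrite /= /ladj eqxx. Qed.
Definition label_gmap w : gmap W L := GMap (@label_map w).

Fact forget_label_map : @graph_map L W fst.
Proof. by move=> p q /andP[]; left. Qed.
Definition forget_label : gmap L W := GMap forget_label_map.

Fact reroot_label_map : @graph_map L W (fun a => wreroot a.2 a.1).
Proof. by move=> [p w] [q w'] /andP[/= /eqP <-]; exact: wreroot_map. Qed.
Definition reroot_label : gmap L W := GMap reroot_label_map.

Fact label_parent_map : @graph_map L L (fun a => (parent a.1, a.2)).
Proof.
move=> [p w] [q w'] /andP[/= /eqP <-] /parent_map /= [h|->]; last by right.
by left; rewrite /ladj eqxx.
Qed.
Definition label_parent : gmap L L := GMap label_parent_map.

Lemma labeled_acyclic n (z : Ccx L n.+1) :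
  bd (Ccx L) n z = 0 -> exists y, bd (Ccx L) n.+1 y = z.
Proof.
apply: (contraction_acyclic (c := label_parent) (rk := fun a => size (wtail a.1))
         (rt := fun a => (trivial_walk (wroot a.1), a.2))).
- move=> [p w]; have [h|h] := parent_near p; first by left; rewrite /= /ladj eqxx.
  by right; rewrite /= -h.
- by move=> [p w] m /iter_parent <-; elim: m => //= m ->.
- by move=> [p w] [q w'] /andP[/= /eqP <- /wroot_adj ->].
Qed.

(** * The resolution by vertices and oriented edges of the tree of roots *)

Definition orient (v w : G) : bool := choose (pred2 v w) v == v.

(** The element chosen from [{v, w}] does not depend on the order of [v] and [w], and it is exactly
    one of the two. *)
Lemma orientN v w : adj v w -> orient w v = ~~ orient v w.
Proof.
move=> vw; have {vw} nvw : v != w by apply: contraTneq vw => ->; rewrite adj_irr.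
have E : choose (pred2 w v) w = choose (pred2 v w) v.
  rewrite (@choose_id _ (pred2 v w) v w) ?inE /= ?eqxx ?orbT //.
  by apply: eq_choose => x; rewrite /= orbC.
rewrite /orient E.
have h : pred2 v w v by rewrite /= eqxx.
have /orP[/eqP ->|/eqP ->] := chooseP h.
- by rewrite eqxx (negPf nvw).
- by rewrite eqxx eq_sym (negPf nvw).
Qed.

Lemma wroot_cube n (t : scube n W) x : wroot (t x) = wroot (t (origin n)).
Proof.
move: x; apply: cube_ind => // i x <-.
by have [/wroot_adj ->|->] := scube_near t x i.
Qed.

Lemma scomp_rerootK n (t : scube n W) v w : wroot (t (origin n)) = v -> adj v w ->
  scomp (reroot_gmap v) (scomp (reroot_gmap w) t) = t.
Proof.
move=> rt a; apply: scube_eq => x; rewrite !scompE /=.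
by rewrite -rt -(wroot_cube t x) wrerootK // wroot_cube rt.
Qed.

(** Adjacent walks have distinct endpoints, so opposite faces with equal projections agree at the
    origin, hence everywhere by [lift_unique]. *)
Lemma degenerate_head n (t : scube n W) :
  degenerate (scomp (head_gmap G) t) -> degenerate t.
Proof.
case: n t => // n t /existsP[i /eqP E]; apply/existsP; exists i; apply/eqP.
rewrite !face_scomp in E; apply: lift_unique => //.
rewrite !faceE -[true]/(~~ false) -flip_cube_insert.
have [/whead_adj|->//] := scube_near t (cube_insert i false (origin n)) i.
have := scompE (head_gmap G) (face i false t) (origin n).
rewrite E scompE !faceE /= flip_cube_insert => ->.
by rewrite adj_irr.
Qed.

(* The edge from the root v to w, where [w, v] = - [v, w]: otherwise delta
   would not be injective. *)
Definition edge (v w : G) n : {additive Ccx W n -> Ccx L n} :=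
  if ~~ adj v w then (\0 : {additive Ccx W n -> Ccx L n})
  else if orient v w then push (label_gmap w) n
  else \- (push (label_gmap v) n \o push (reroot_gmap w) n).

Lemma edge_bd v w n x : edge v w n (bd (Ccx W) n x) = bd (Ccx L) n (edge v w n.+1 x).
Proof.
rewrite /edge; case: ifP => _ /=; first by rewrite raddf0.
case: ifP => _; first exact: push_bd.
by rewrite /= !push_bd raddfN.
Qed.

(** The edge-to-vertex boundary of the tree of roots: the start of the root edge minus its end. *)
Definition delta n : {additive Ccx L n -> Ccx W n} :=
  push forget_label n \- push reroot_label n.

Lemma delta_bd n x : delta n (bd (Ccx L) n x) = bd (Ccx W) n (delta n.+1 x).
Proof. by rewrite [LHS]/= !push_bd -raddfB. Qed.

Lemma delta_label w n x :
  delta n (push (label_gmap w) n x) = x - push (reroot_gmap w) n x.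
Proof.
apply: (additive_ext (f := delta n \o push (label_gmap w) n)
                     (g := idfun \- push (reroot_gmap w) n)) => s _.
rewrite [LHS]/= !push_class /= push_class.
by congr (_ - _); congr Cclass; apply: scube_eq => y; rewrite !scompE.
Qed.

Lemma edge_antisym n (t : scube n W) v w : wroot (t (origin n)) = v -> adj v w ->
  edge w v n (Cclass (scomp (reroot_gmap w) t)) = - edge v w n (Cclass t).
Proof.
move=> rt vw; rewrite /edge adj_sym vw /= (orientN vw); case: (orient v w) => /=.
  by rewrite !push_class scomp_rerootK.
by rewrite !push_class opprK.
Qed.

(** For the reversed orientation the sign in [edge] compensates. For nonadjacent [v] and [w] both
    sides vanish, as rerooting does nothing. *)
Lemma delta_edge n (t : scube n W) v w : wroot (t (origin n)) = v ->
  delta n (edge v w n (Cclass t)) = Cclass t - Cclass (scomp (reroot_gmap w) t).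
Proof.
move=> rt; rewrite /edge; have [a|na] := boolP (adj v w).
  case: (orient v w); first by rewrite delta_label push_class.
  rewrite [in LHS]/= -[LHS]/(delta n (- _)) raddfN delta_label !push_class.
  by rewrite scomp_rerootK // opprB.
rewrite [in LHS]/= -[LHS]/(delta n 0) raddf0; apply/esym/eqP; rewrite subr_eq0.
apply/eqP; congr Cclass; apply: scube_eq => x; rewrite scompE /= wreroot_nonadj //.
by rewrite wroot_cube rt.
Qed.

Definition is_lift n (s : scube n G) (t : scube n W) : Prop :=
  scomp (head_gmap G) t = s /\ t (origin n) = trivial_walk (s (origin n)).

(** The lift rooted at the image of the origin, and 0 on cubes without a lift. It need not commute
    with boundaries, since a face at 1 may have its origin elsewhere. *)
Definition lift_chain n : {additive Ccx G n -> Ccx W n} :=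
  Clift (fun s => if pselect (exists t, is_lift s t) is left H
                  then Cclass (projT1 (cid H)) else 0).

Lemma lift_class n (s : scube n G) t :
  is_lift s t -> lift_chain n (Cclass s) = Cclass t.
Proof.
move=> st; have E : (if pselect (exists t, is_lift s t) is left H
    then Cclass (projT1 (cid H)) else 0) = Cclass t.
  case: pselect => [H|[]]; last by exists t.
  have [E1 E2] := projT2 (cid H); case: st => E3 E4.
  by congr Cclass; apply: lift_unique; rewrite ?E1 ?E2.
rewrite -[RHS]E; apply: CliftE => ds; rewrite E.
by apply/Cclass_degenerate/degenerate_head; case: st => ->.
Qed.

(* The sum of the edges along the walk t (origin n), from the root on; it
   telescopes under delta. *)
Fixpoint path_sum m n (t : scube n W) : Ccx L n :=
  if m is m'.+1 then
    let p := t (origin n) in let w := next_to_root (whead p) (wtail p) in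
    edge (wroot p) w n (Cclass t) + path_sum m' (scomp (reroot_gmap w) t)
  else 0.

Definition base_path n (t : scube n W) : Ccx L n :=
  path_sum (size (wtail (t (origin n)))) t.

Lemma path_sum_degenerate m n (t : scube n W) : degenerate t -> path_sum m t = 0.
Proof.
elim: m t => [//|m IH] t dt /=.
by rewrite Cclass_degenerate // raddf0 add0r IH // degenerate_scomp.
Qed.

Definition base_path_chain n : {additive Ccx W n -> Ccx L n} := Clift (@base_path n).

Lemma base_path_class n (t : scube n W) : base_path_chain n (Cclass t) = base_path t.
Proof. by apply: CliftE => dt; apply: path_sum_degenerate. Qed.

Lemma base_path_next n (t : scube n W) w : let p := t (origin n) in
    wtail p != [::] -> next_to_root (whead p) (wtail p) = w ->
  base_path t = edge (wroot p) w n (Cclass t) + base_path (scomp (reroot_gmap w) t).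
Proof.
move=> p pn Ew; rewrite /base_path scompE /= -/p.
have -> : size (wtail (wreroot w p)) = (size (wtail p)).-1.
  rewrite {1}/wtail /= -Ew; case: (wtail p) pn => //= y r _.
  exact: size_reroot_next.
by rewrite -size_eq0 in pn; case: (size _) pn => //= m _; rewrite -/p Ew.
Qed.

(** One of the two walks starts with the edge between the roots and continues as the other; when it
    is the rerooted one, [edge_antisym] supplies the sign. *)
Lemma base_path_reroot n (t : scube n W) v w : wroot (t (origin n)) = v ->
  base_path t - base_path (scomp (reroot_gmap w) t) = edge v w n (Cclass t).
Proof.
move=> rt; have [a|na] := boolP (adj v w); last first.
  rewrite /edge na /=; apply/eqP; rewrite subr_eq0; apply/eqP; congr base_path.
  apply/esym/scube_eq => x; rewrite scompE /= wreroot_nonadj //.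
  by rewrite wroot_cube rt.
have := @next_reroot G w (whead (t (origin n))) (wtail (t (origin n))) (reduced_walk _).
rewrite -/(wroot _) rt => /(_ a) [[qn E]|[qn E]].
  by rewrite (base_path_next qn E) rt addrK.
have := @base_path_next n (scomp (reroot_gmap w) t) v.
rewrite scompE /= wroot_reroot ?rt // => /(_ qn E) ->.
by rewrite edge_antisym // scomp_rerootK // opprD opprK addrCA subrr addr0.
Qed.

(** The root moves along the walk until the walk at the origin is trivial; the cube reached is then
    the lift chosen by [lift_chain]. *)
Lemma delta_base_path n (t : scube n W) :
  delta n (base_path t) = Cclass t - lift_chain n (Cclass (scomp (head_gmap G) t)).
Proof.
have [m] := ubnP (size (wtail (t (origin n)))); elim: m t => // m IH t.
case: (eqVneq (wtail (t (origin n))) [::]) => [E _|ne].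
  rewrite /base_path E raddf0 (@lift_class _ _ t) ?subrr //; split=> //.
  by rewrite scompE; apply: rwalk_eq.
rewrite (base_path_next ne (erefl _)) raddfD delta_edge //.
set w := next_to_root _ _ => h; rewrite IH.
  rewrite addrA subrK; congr (_ - lift_chain n (Cclass _)).
  by apply: scube_eq => x; rewrite !scompE.
rewrite scompE {1}/wtail /= {}/w; case: (wtail _) ne h => // y r _.
by rewrite size_reroot_next.
Qed.

Lemma label_cube n (r : scube n L) x : (r x).2 = (r (origin n)).2.
Proof.
move: x; apply: cube_ind => // i x <-.
by have [/andP[/eqP ->]|->] := scube_near r x i.
Qed.

(* The projection of C(L) onto the span of the correctly oriented edges, on which
   delta is injective. *)
Definition normalize n : {additive Ccx L n -> Ccx L n} :=
  Clift (fun r : scube n L =>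
    edge (wroot (r (origin n)).1) (r (origin n)).2 n (Cclass (scomp forget_label r))).

Lemma normalize_class n (r : scube n L) v w :
    wroot (r (origin n)).1 = v -> (r (origin n)).2 = w ->
  normalize n (Cclass r) = edge v w n (Cclass (scomp forget_label r)).
Proof.
move=> <- <-; apply: CliftE => dr.
by rewrite Cclass_degenerate ?raddf0 // degenerate_scomp.
Qed.

Lemma normalize_edge n (t : scube n W) v w : wroot (t (origin n)) = v ->
  normalize n (edge v w n (Cclass t)) = edge v w n (Cclass t).
Proof.
move=> rt; have [a|na] := boolP (adj v w); last by rewrite /edge na /= raddf0.
rewrite {1}/edge a /=; have forgetK u (s : scube n W) :
    scomp forget_label (scomp (label_gmap u) s) = s.
  by apply: scube_eq => x; rewrite !scompE.
case: (orient v w) => /=.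
  by rewrite push_class (@normalize_class _ _ v w) ?forgetK // scompE.
rewrite raddfN !push_class (@normalize_class _ _ w v) ?forgetK.
- by rewrite edge_antisym // opprK.
- by rewrite !scompE /= wroot_reroot // rt.
- by rewrite scompE.
Qed.

(** Base paths are sums of edges, which [normalize] fixes. *)
Lemma normalize_base_path n x :
  normalize n (base_path_chain n x) = base_path_chain n x.
Proof.
apply: (additive_ext (f := normalize n \o base_path_chain n)
                     (g := base_path_chain n)) => t _.
rewrite -[LHS]/(normalize n (base_path_chain n (Cclass t))).
rewrite base_path_class /base_path; move: (size _) => m.
elim: m t => [|m IH] t; first by rewrite raddf0.
by rewrite [path_sum _ _]/= raddfD IH normalize_edge.
Qed.

(** Root and label are constant on a cube, so all its faces are treated with the same edge. *)
Lemma normalize_bd n x : normalize n (bd (Ccx L) n x) = bd (Ccx L) n (normalize n.+1 x).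
Proof.
apply: (additive_ext (f := normalize n \o bd (Ccx L) n)
                     (g := bd (Ccx L) n \o normalize n.+1)) => r _.
rewrite [LHS]/= [RHS]/= (normalize_class (erefl _) (erefl _)) -edge_bd.
rewrite !bd_Cclass !raddf_sum; apply: eq_bigr => i _.
rewrite !raddfMz !raddfB; congr (_ *~ _).
have E e : normalize n (Cclass (face i e r)) =
    edge (wroot (r (origin n.+1)).1) (r (origin n.+1)).2 n
      (Cclass (face i e (scomp forget_label r))).
  rewrite face_scomp; apply: normalize_class; rewrite faceE ?label_cube //.
  have := wroot_cube (scomp forget_label r) (cube_insert i e (origin n)).
  by rewrite !scompE.
by rewrite !E.
Qed.

(** The paths from the two ends of the labelled edge differ by that edge. Hence [delta] is injective
    on normalized chains. *)
Lemma base_path_delta n x : base_path_chain n (delta n x) = normalize n x.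
Proof.
apply: (additive_ext (f := base_path_chain n \o delta n) (g := normalize n)) => r _.
rewrite [LHS]/= !push_class raddfB !base_path_class.
rewrite (normalize_class (erefl _) (erefl _)) -base_path_reroot ?scompE //.
congr (_ - base_path _); apply: scube_eq => y; rewrite !scompE /=.
by rewrite label_cube.
Qed.

(** Exactness in the middle: a chain that projects to 0 lies in the image of [delta]. *)
Lemma delta_base_path_chain n x : delta n (base_path_chain n x) =
  x - lift_chain n (push (head_gmap G) n x).
Proof.
apply: (additive_ext (f := delta n \o base_path_chain n)
    (g := idfun \- (lift_chain n \o push (head_gmap G) n))) => t _.
rewrite -[LHS]/(delta n (base_path_chain n (Cclass t))).
by rewrite base_path_class delta_base_path -push_class.
Qed.

Lemma push_head_Cfil n x : push (head_gmap G) n x \in Cfil G 1 n.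
Proof.
move: x; apply: Cchain_ind => [|x y Px Py|t _]; first by rewrite raddf0 rpred0.
  by rewrite raddfB rpredB.
by rewrite push_class; apply/Cclass_in/degree_le1P/flat_head.
Qed.

Lemma push_head_delta n x : push (head_gmap G) n (delta n x) = 0.
Proof.
apply: (additive_ext (f := push (head_gmap G) n \o delta n)
  (g := (\0 : {additive Ccx L n -> Ccx G n}))) => r _ /=.
rewrite raddfB !push_class; apply/eqP; rewrite subr_eq0; apply/eqP.
by congr Cclass; apply: scube_eq => y; rewrite !scompE.
Qed.

Hypothesis tfG : triangle_free G.

Lemma push_head_lift n x : x \in Cfil G 1 n ->
  push (head_gmap G) n (lift_chain n x) = x.
Proof.
move=> x1; suff: x \in kerz ((push (head_gmap G) n \o lift_chain n) \- idfun).
  by rewrite inE /= subr_eq0 => /eqP.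
move: x x1; apply: genz_sub => _ [s /andP[_ /degree_le1P fs] ->].
have [t st] := lift_exists tfG fs.
by rewrite inE /= (lift_class st) push_class; case: st => -> _; rewrite subrr.
Qed.

Lemma Cfil1_acyclic n (z : Ccx G n.+2) :
    z \in Cfil G 1 n.+2 -> bd (Ccx G) n.+1 z = 0 ->
  exists2 y, y \in Cfil G 1 n.+3 & bd (Ccx G) n.+2 y = z.
Proof.
move=> z1 z0; pose s := lift_chain n.+2 z.
pose k := base_path_chain n.+1 (bd (Ccx W) n.+1 s).
(* The boundary of [s] projects to that of [z], which is 0, so the correction by [lift_chain]
   disappears. *)
have dk : delta n.+1 k = bd (Ccx W) n.+1 s.
  by rewrite delta_base_path_chain push_bd push_head_lift // z0 raddf0 subr0.
(* The chain [k] is normalized, so its boundary can be recovered from the image under [delta], which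
   is the boundary of a boundary. *)
have k0 : bd (Ccx L) n k = 0.
  rewrite -[k]normalize_base_path -normalize_bd -base_path_delta delta_bd dk.
  by rewrite bdK raddf0.
(* Here [z] must have dimension at least 2: [k] lies one dimension lower, which has to be
   positive. *)
have [y yk] := labeled_acyclic k0.
have s0 : bd (Ccx W) n.+1 (s - delta n.+2 y) = 0.
  by rewrite raddfB -delta_bd yk dk subrr.
have [x xE] := walk_acyclic s0.
exists (push (head_gmap G) n.+3 x); first exact: push_head_Cfil.
by rewrite -push_bd xE raddfB push_head_delta subr0 push_head_lift.
Qed.
End Covering.

(** * Homology of the filtration *)

(** First isomorphism theorem, with the inverse map obtained by classical choice. *)
Lemma quotz_iso (U V : zmodType) (I : zmodClosed U) (f : {additive U -> V}) :
    (forall x, f x = 0 <-> x \in I) -> (forall y, exists x, f x = y) ->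
  zmod_iso (quotz I) V.
Proof.
move=> kerf surjf; pose g (x : quotz I) : V := f (repr x).
have gE x : g (\pi_(quotz I) x) = f x.
  apply/eqP; rewrite -subr_eq0 /g -raddfB; apply/eqP/kerf.
  by rewrite -pi_eq0 raddfB /= reprK subrr.
have gB : zmod_morphism g.
  by move=> x y; rewrite -[x]reprK -[y]reprK -raddfB !gE raddfB.
pose ga : {additive quotz I -> V} := HB.pack g (GRing.isZmodMorphism.Build _ _ g gB).
have ginj : injective g.
  move=> x y /eqP; rewrite -subr_eq0 -gB -[x]reprK -[y]reprK -raddfB gE => /eqP/kerf.
  by rewrite -pi_eq0 raddfB /= subr_eq0 => /eqP.
have gsurj y : exists x, g x = y.
  by have [x <-] := surjf y; exists (\pi_(quotz I) x).
exists ga; exists (fun y => projT1 (cid (gsurj y))) => [x|y].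
  by apply: ginj; apply: (projT2 (cid (gsurj (g x)))).
exact: (projT2 (cid (gsurj y))).
Qed.

Lemma homology_iso (K L : complex) (f : forall n, {additive K n -> L n}) n :
    (forall n x, f n (bd K n x) = bd L n (f n.+1 x)) ->
    (forall x, x \in cycles K n -> f n x \in boundaries L n -> x \in boundaries K n) ->
    (forall y, y \in cycles L n ->
       exists2 x, x \in cycles K n & f n x - y \in boundaries L n) ->
  zmod_iso (homology K n) (homology L n).
Proof.
move=> fbd inj surj.
have fcyc x : x \in cycles K n -> f n x \in cycles L n.
  by case: n x {inj surj} => // n x; rewrite !inE -fbd => /eqP ->; rewrite raddf0.
pose g : {additive subz (cycles K n) -> homology L n} :=
  (\pi_(homology L n) : {additive _ -> _}) \o restrz fcyc.
have gE x : (g x == 0) = (f n (val x) \in boundaries L n).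
  by rewrite /g /= pi_eq0 inE.
apply: (quotz_iso (f := g)) => [x|y].
  rewrite [x \in _]inE; split=> [/eqP|xb]; first by rewrite gE; apply/inj/subzP.
  apply/eqP; rewrite gE; move: xb; rewrite !inE => /asboolP[z <-].
  by apply/asboolP; exists (f n.+1 z); rewrite fbd.
rewrite -[y]reprK; have [x xK xy] := surj _ (subzP (repr y)); exists (Subz xK).
apply/eqP; rewrite -subr_eq0 /g /= -raddfB pi_eq0 inE /=.
exact: xy.
Qed.

(** * Filtrations whose stage 1 is acyclic from dimension 2 on *)

Section FiltrationHomology.
Variables (K : complex) (F : nat -> subcomplex K).
Hypothesis F_full : forall n (x : K n), x \in F n n.

Lemma diag_class_eq0 n (x : K n) : diag_class F_full x = 0 ->
  exists2 y, y \in F n n.+1 & x - bd K n y \in fil_pred F n n.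
Proof.
move=> /eqP; rewrite pi_eq0 inE /= => /asboolP[y].
rewrite -[y]reprK /= quotz_mapE => /eqP; rewrite -subr_eq0.
rewrite /gr_class -raddfB pi_eq0 inE /= => h.
exists (val (repr y)); first exact: subzP.
by rewrite -opprB rpredN.
Qed.

Lemma diag_class_pred n (x : K n) :
  x \in fil_pred F n n -> diag_class F_full x = 0.
Proof.
move=> xF; apply/eqP; rewrite pi_eq0 inE /=; apply/asboolP; exists 0.
by rewrite raddf0; apply/esym/eqP; rewrite pi_eq0 inE.
Qed.

Hypothesis F1_acyclic : forall n (z : K n.+2), z \in F 1 n.+2 -> bd K n.+1 z = 0 ->
  exists2 y, y \in F 1 n.+3 & bd K n.+2 y = z.

Lemma homology2_diag :
  (forall x : K 1%N, x \in F 0 1%N -> x = 0) ->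
  zmod_iso (homology K 2) (homology (diagcx F_full) 2).
Proof.
move=> F01; pose f n : {additive K n -> diagcx F_full n} := @diag_class K F F_full n.
apply: (@homology_iso K (diagcx F_full) f).
- by move=> n x; apply/esym/d1_class.
- move=> x; rewrite !inE => /eqP x0 /asboolP[z zx].
  have {}zx : d1 F_full (diag_class F_full (diag_repr z)) = diag_class F_full x.
    by rewrite diag_reprK.
  rewrite d1_class in zx; apply/asboolP; move: (diag_repr z) zx => {}z zx.
  (* Up to boundaries [x] becomes a cycle of stage 1 in dimension 2, which acyclicity kills. *)
  have /diag_class_eq0[y _ yF] : diag_class F_full (x - bd K 2 z) = 0.
    by rewrite diag_class_additive zx subrr.
  have [|v _ vE] := F1_acyclic yF; first by rewrite !raddfB x0 !bdK !subr0.
  by exists (z + y + v); rewrite !raddfD vE addrC addrACA subrK addNr addr0.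
move=> y; rewrite inE => /eqP y0.
have {}y0 : d1 F_full (diag_class F_full (diag_repr y)) = 0 by rewrite diag_reprK.
rewrite -[y](@diag_reprK K F F_full 2); move: (diag_repr y) y0 => {}y.
(* Stage 0 vanishes in dimension 1, so [y] and some [u] of stage 1 have equal boundaries; [y - u] is
   a genuine cycle in the same diagonal class. *)
rewrite d1_class => /diag_class_eq0[u uF].
move=> /F01/eqP; rewrite subr_eq0 => /eqP E; exists (y - u).
  by rewrite inE raddfB E subrr.
by rewrite [f _ _]diag_class_additive (diag_class_pred (n := 2) uF) subr0 subrr rpred0.
Qed.

Hypothesis F2_full : forall n (x : K n), x \in F 2 n.

(** As stage 2 is everything, this is the projection of [K] onto its quotient by stage 1. *)
Definition gr2_class n (x : K n) : gr F 2 n := \pi_(quotz _) (Subz (F2_full x)).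

Fact gr2_class_additive n : zmod_morphism (@gr2_class n).
Proof. by move=> x y; rewrite /gr2_class -raddfB; congr \pi; apply: val_inj. Qed.
HB.instance Definition _ n :=
  GRing.isZmodMorphism.Build (K n) (gr F 2 n) (@gr2_class n) (@gr2_class_additive n).

Lemma gr2_class_bd n x : gr2_class (bd K n x) = bd (gr F 2) n (gr2_class x).
Proof. by rewrite /= quotz_mapE; congr \pi; apply: val_inj. Qed.

Lemma gr2_class_eq0 n (x : K n) : (gr2_class x == 0) = (x \in F 1 n).
Proof. by rewrite pi_eq0 inE. Qed.

Lemma gr2_class_surj n (y : gr F 2 n) : exists x, y = gr2_class x.
Proof.
exists (val (repr y)); rewrite -[LHS]reprK; congr \pi; exact: val_inj.
Qed.

(** The long exact sequence done by hand: acyclicity of stage 1 is used in the given dimension for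
    injectivity and one dimension lower for surjectivity, whence the bound 3. *)
Lemma homology_gr2 n : zmod_iso (homology K n.+3) (homology (gr F 2) n.+3).
Proof.
pose f n : {additive K n -> gr F 2 n} := @gr2_class n.
apply: (@homology_iso K (gr F 2) f).
- exact: gr2_class_bd.
- move=> x; rewrite !inE => /eqP x0 /asboolP[z]; have [{}z ->] := gr2_class_surj z.
  move=> /eqP; rewrite -gr2_class_bd eq_sym -subr_eq0 -raddfB gr2_class_eq0 => zx.
  have [|v _ vE] := F1_acyclic zx; first by rewrite raddfB x0 bdK subr0.
  by apply/asboolP; exists (z + v); rewrite raddfD vE addrC subrK.
move=> y; have [{}y ->] := gr2_class_surj y; rewrite inE -gr2_class_bd gr2_class_eq0.
move=> yF; have [|u uF uE] := F1_acyclic yF; first by rewrite bdK.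
exists (y - u); first by rewrite inE raddfB uE subrr.
move: uF; rewrite -gr2_class_eq0 => /eqP uF.
by rewrite raddfB [X in _ - X - _]uF subr0 subrr rpred0.
Qed.
End FiltrationHomology.

(** * Cubes of degree 0, and degrees bounded by the cubical dimension *)

Section CubicalFiltration.
Variable G : sgraph.

(** If the two faces in direction 0 differ at some [x], the edge over [x] in that direction is an
    injective face of dimension 1. *)
Lemma Cfil0_eq0 n (x : Ccx G n.+1) : x \in Cfil G 0 n.+1 -> x = 0.
Proof.
move=> x0; apply/eqP; suff: x \in zerocx (Ccx G) n.+1 by rewrite inE.
move: x x0; apply: genz_sub => _ [s /andP[/negP sd s0] ->].
case: sd; apply/existsP; exists ord0; apply/eqP/scube_eq => x; rewrite !faceE.
apply/eqP/negPn/negP => ne; move: s0; rewrite leqNgt => /negP; apply.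
pose c : {ffun 'I_n.+1 -> option bool} :=
  [ffun k => if unlift ord0 k is Some j then Some (x j) else None].
have in_c y : y \in in_face c -> y = cube_insert ord0 (y ord0) x.
  rewrite inE => /forallP yc; apply/ffunP => k; have := yc k; rewrite !ffunE.
  by case: (unliftP ord0 k) => [j|] -> // /eqP.
have cinj : {in in_face c &, injective s}.
  move=> y z /in_c -> /in_c ->.
  case: (y ord0) (z ord0) => [] [] // E; move: ne; by rewrite E eqxx.
apply: leq_trans (leq_bigmax_cond _ (asboolT cinj)).
by rewrite card_gt0; apply/set0Pn; exists ord0; rewrite inE ffunE unlift_none.
Qed.

(** An injective face, parametrized by its free coordinates, is an injective singular cube. *)
Lemma degree_le_dim d n (s : scube n G) : cubical_dim G d -> (degree s <= d)%N.
Proof.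
move=> [_ dimG]; apply/bigmax_leqP => c /asboolP cinj.
pose A := [set i | c i == None].
(* The existential reads the coordinate of [x] whose index enumerates the free coordinate [i]. *)
pose f (x : cube #|A|) : cube n :=
  [ffun i => if c i is Some b then b else [exists j, (enum_val j == i) && x j]].
have fE x j : f x (enum_val j) = x j.
  have := enum_valP j; rewrite inE ffunE => /eqP ->.
  apply/existsP/idP => [[k /andP[/eqP /enum_val_inj -> //]]|xj].
  by exists j; rewrite eqxx.
have f_face x : f x \in in_face c.
  by rewrite inE; apply/forallP => i; rewrite ffunE; case: (c i).
have f_flip x j : f (flip j x) = flip (enum_val j) (f x).
  apply/ffunP => i; rewrite [RHS]ffunE; case: (boolP (i \in A)) => iA.
    rewrite -[i](enum_rankK_in iA) // !fE ffunE (inj_eq enum_val_inj) //.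
  have ne : i != enum_val j by apply: contraNneq iA => ->; apply: enum_valP.
  rewrite (negPf ne) addbF !ffunE; move: iA; rewrite inE; by case: (c i).
have H : `[< @graph_map (cube_graph #|A|) G [ffun x => s (f x)] >].
  by apply: flip_scube => x j; rewrite f_flip; apply: scube_near.
apply: (dimG _ (SCube H)) => x y; rewrite !ffunE => /cinj E.
by apply/ffunP => j; rewrite -!fE E.
Qed.

Lemma Cfil_dim d n (x : Ccx G n) : cubical_dim G d -> x \in Cfil G d n.
Proof.
move=> dimG; move: x; apply: Cchain_ind => [|x y Px Py|s _]; first exact: rpred0.
  by rewrite rpredB.
exact/Cclass_in/degree_le_dim.
Qed.
End CubicalFiltration.

Theorem corollary4p8 (G : sgraph) (tfG : triangle_free G) :
  zmod_iso (cubical_homology G 2) (injective_homology G 2) /\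
  (cubical_dim G 2 -> forall n : nat, (3 <= n)%N ->
     zmod_iso (cubical_homology G n) (degree_homology G 2 n)).
Proof.
split=> [|dimG [|[|[|n]]] // _].
  apply: homology2_diag; last exact: Cfil0_eq0.
  exact: Cfil1_acyclic.
apply: homology_gr2; last by move=> m x; apply: Cfil_dim.
exact: Cfil1_acyclic.
Qed.
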